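(* For any $a\in(1/2,1)$ the transfer operator $\mathcal L_a$ on $BV(I)$ has a leading eigenvalue (an eigenvalue equal to its spectral radius) which is simple. In particular, the topological entropy $h(a)=h_{top}(T,[a,1])$ of the doubling map $T(x)=2x \bmod 1$ with hole $[a,1]$ satisfies, for every $a\in(1/2,1)$, $$\mathrm{H\ddot{o}l}(h,a)\ \ge\ \frac{h(a)}{\log 2}\,.$$
   Context: $I=[0,1]$ and $T(x)=2x\bmod 1$ is considered on $(0,1/2)\cup(1/2,1)$, with initial partition $\mathcal Z=\{(0,1/2),(1/2,1)\}$. $BV(I)$ is the complex Banach space of (classes of) functions $f\in L^1(I)$ such that $\mathrm{var}_I(f)$, the infimum of the total variations of all versions of $f$, is finite, with norm $\mathrm{var}_I(f)+\int_I|f|\,dm$ ($m$ Lebesgue measure). For $a\in(1/2,1)$ the transfer operator is $$(\mathcal L_af)(x)=f\Big(\frac x2\Big)+\chi_{(0,a)}\Big(\frac{1+x}2\Big)f\Big(\frac{1+x}2\Big).$$ Simple means of algebraic multiplicity one. For the hole $H=[a,1]$, let $\mathcal Z^H=\{Z\cap(I\setminus H)\neq\emptyset:Z\in\mathcal Z\}=\{(0,1/2),(1/2,a)\}$ and let $\mathcal Z^H_n$ be the collection of non-empty sets $Z_0\cap T^{-1}Z_1\cap\dots\cap T^{-(n-1)}Z_{n-1}$ with $Z_i\in\mathcal Z^H$. Then $h_{top}(T,H)=\lim_{n\to\infty}\frac1n\log^+\mathrm{card}\,\mathcal Z^H_n$, where $\log^+(t)=\max\{0,\log t\}$. A function $h$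 between metric spaces $X,Y$ is Hölder continuous at $t\in X$ if there is $\alpha\in(0,1]$ with $\limsup_{s\to t}d_Y(h(s),h(t))/d_X(s,t)^\alpha<\infty$; in that case the local Hölder exponent $\mathrm{H\ddot{o}l}(h,t)$ is the supremum of all such $\alpha\in(0,1]$. *)

(* Defs.v *)
From HB Require Import structures.
From mathcomp Require Import all_boot all_order all_algebra.
From mathcomp Require Import finmap.
From mathcomp Require Import all_classical all_reals all_analysis.
From mathcomp Require Import complex.

Set Implicit Arguments.
Unset Strict Implicit.
Unset Printing Implicit Defensive.

Import Order.TTheory GRing.Theory Num.Theory.
Import numFieldNormedType.Exports.

Local Open Scope classical_set_scope.
Local Open Scope ring_scope.
Local Open Scope complex_scope.

(* A class of functions on I = [0,1] is represented by any of its members,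
   extended arbitrarily outside I; equality in BV(I) is then [aeI]. *)
Section BV.
Context {R : realType}.
Implicit Types f g : R -> R[i].

Local Notation mu := (@lebesgue_measure R).

Definition aeI f g : Prop := {ae mu, forall x, x \in `[0, 1]%R -> f x = g x}.

(* Complex-valued analogues of [variation] and [total_variation]. *)
Definition cvariation (a b : R) f (s : seq R) : R :=
  let F := f \o nth b (a :: s) in
  \sum_(0 <= n < size s) Normc.normc (F n.+1 - F n).

Definition ctotal_variation (a b : R) f : \bar R :=
  ereal_sup [set (cvariation a b f s)%:E | s in itv_partition a b].

Definition varI f : \bar R :=
  ereal_inf [set ctotal_variation 0 1 g | g in aeI f].

Definition L1I f : Prop :=
  mu.-integrable `[0, 1] (fun x => (complex.Re (f x))%:E) /\
  mu.-integrable `[0, 1] (fun x => (complex.Im (f x))%:E).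

Definition BVI f : Prop := L1I f /\ (varI f < +oo)%E.

Definition BVnorm f : \bar R :=
  (varI f + \int[mu]_(x in `[0%R, 1%R]) (Normc.normc (f x))%:E)%E.

Definition op_minus (L : (R -> R[i]) -> R -> R[i]) (z : R[i]) f : R -> R[i] :=
  fun x => L f x - z * f x.

(* [op_minus L z], i.e. L - z, is bijective on BV(I) with bounded inverse. *)
Definition resolvent_set (L : (R -> R[i]) -> R -> R[i]) : set R[i] :=
  [set z | (forall f, BVI f -> aeI (op_minus L z f) (cst 0) -> aeI f (cst 0)) /\
    exists C : R, forall g, BVI g -> exists f,
      [/\ BVI f, aeI (op_minus L z f) g & (BVnorm f <= C%:E * BVnorm g)%E]].

Definition spectrum (L : (R -> R[i]) -> R -> R[i]) : set R[i] :=
  ~` resolvent_set L.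

Definition spectral_radius (L : (R -> R[i]) -> R -> R[i]) : \bar R :=
  ereal_sup [set (Normc.normc z)%:E | z in spectrum L].

Definition BV_eigenvalue (L : (R -> R[i]) -> R -> R[i]) (z : R[i]) : Prop :=
  exists f, [/\ BVI f, ~ aeI f (cst 0) & aeI (op_minus L z f) (cst 0)].

Definition generalized_eigenspace (L : (R -> R[i]) -> R -> R[i]) (z : R[i]) :
    set (R -> R[i]) :=
  [set f | BVI f /\ exists n, aeI (iter n (op_minus L z) f) (cst 0)].

(* Algebraic multiplicity one: the generalized eigenspace is a line. *)
Definition simple (L : (R -> R[i]) -> R -> R[i]) (z : R[i]) : Prop :=
  exists2 f, generalized_eigenspace L z f /\ ~ aeI f (cst 0) &
    forall g, generalized_eigenspace L z g ->
      exists c : R[i], aeI g (fun x => c * f x).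

Definition leading_eigenvalue (L : (R -> R[i]) -> R -> R[i]) (r : R) : Prop :=
  BV_eigenvalue L r%:C /\ r%:E = spectral_radius L.

Definition transfer (a : R) f : R -> R[i] := fun x =>
  f (x / 2) + (\1_(`]0, a[%classic) ((1 + x) / 2) : R)%:C * f ((1 + x) / 2).

End BV.

Section entropy.
Context {R : realType}.

Definition doubling (x : R) : R := 2 * x - (Num.floor (2 * x))%:~R.

Definition Zpart : set (set R) := [set `]0, 2^-1[%classic; `]2^-1, 1[%classic].

(* Preimage under T as a map defined only on (0,1/2) `|` (1/2,1). *)
Definition Tpreimage (A : set R) : set R :=
  (`]0, 2^-1[%classic `|` `]2^-1, 1[%classic) `&` doubling @^-1` A.

Definition ZH (H : set R) : set (set R) :=
  [set B | B !=set0 /\ exists2 Z, Zpart Z & B = Z `&` (`[0, 1]%classic `\` H)].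

Definition ZHn (H : set R) (n : nat) : set (set R) :=
  [set B | B !=set0 /\ exists2 Z : nat -> set R,
    (forall i, (i < n)%N -> ZH H (Z i)) &
    B = \bigcap_(i in `I_n) iter i Tpreimage (Z i)].

Definition log_plus (t : R) : R := Num.max 0 (ln t).

(* [ZHn H n] is finite, as [Zpart] is, so [fset_set] is meaningful. *)
Definition htop (H : set R) : R :=
  limn (fun n : nat => n%:R^-1 * log_plus (#|` fset_set (ZHn H n)|)%:R).

End entropy.

(* Hölder continuity at t of a function defined on the metric subspace X. *)
Section hoelder.
Context {R : realType} {S Y : metricType R}.
Implicit Types (X : set S) (h : S -> Y) (t : S).

Definition hoelder_exponents X h t : set R :=
  [set alpha | 0 < alpha <= 1 /\
    (limf_esup (fun s => (mdist (h s) (h t) / mdist s t `^ alpha)%:E)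
               (within X t^') < +oo)%E].

Definition hoelder_continuous_at X h t : Prop :=
  hoelder_exponents X h t !=set0.

Definition Hoel X h t : R := sup (hoelder_exponents X h t).

End hoelder.

(* Main.v *)
Require Import Defs.
From mathcomp Require Import all_boot all_order all_algebra finmap.
From mathcomp Require Import all_classical all_reals all_analysis.
From mathcomp Require Import measurable_realfun complex ring lra.
Import Order.TTheory GRing.Theory Num.Theory.
Import numFieldNormedType.Exports.
Local Open Scope classical_set_scope.
Local Open Scope ring_scope.
Local Open Scope complex_scope.

Set Implicit Arguments.
Unset Strict Implicit.
Unset Printing Implicit Defensive.

(** Why the theorem holds.  Write e_c for the indicator function of (0,c).
The transfer operator L_a maps e_c to e_{c'}, plus the constant 1 if c > 1/2,
where c' = 2c if c <= 1/2 and c' = 2 min(c,a) - 1 if c > 1/2 (rtransfer_step).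
Let c_0 = 1, c_1, c_2, ... be the orbit of 1 under c |-> c', and let the digit
d_k be 1 if c_k > 1/2 and 0 otherwise.  Then f = sum_k lam^-k e_{c_k} satisfies
L_a f = lam f as soon as sum_k d_k lam^-(k+1) = 1.  Since d_0 = 1 and a further
digit is 1, this equation has a root lam in (1,2] (growth_rate_ex); it is the
leading eigenvalue, and h(a) = ln lam.

Spectrum.  Nonnegative nonincreasing functions on [0,1] form a cone that L_a
preserves, and every function of bounded variation is a difference of two of
its members whose values at 0 are controlled by the BV norm (BVI_cone_diff).
On the cone, the value at 0 bounds both the variation and the supremum, and
1 <= f on [0,1) gives (L_a^n 1)(0) <= lam^n f(0).  Hence the Neumann series
at z converges in BV(I) if |z| > lam (neumann_solve), and L_a u = z u forces
|z|^n |u| = |L_a^n u| = O(lam^n), so u = 0 (transfer_injective).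

Simplicity.  A Jordan block would make L_a^n u grow like n lam^n (no_jordan).
For an eigenfunction u = p - r with p and r in the cone, subtract from L_a p
and L_a r the right limits of p and r at 1/2: what remains on (0,1] is again
nonnegative and nonincreasing, and has the same bound (open_cone_reduce).
After n steps u = O(lam^-n) + b sum_{k<n} lam^-(k+1) e_{c_k} almost everywhere,
where b is the essential right limit of u at 1/2, so u is a multiple of f
(eigen_line).

Entropy.  T maps the part of (0,c) in a set of the partition onto (0,1) or
(0,c'), by the same rule as for e_c, so the number of cylinders of length n
that meet (0,c) is (L_a^n e_c)(0) (count_iter_rtransfer).  For c = 1 it is the
number of nonempty cylinders, and lies between lam^n and lam^n f(0).

Hölder continuity.  Let v(c) = sum_k d_k(c) lam^-(k+1), where d_k(c) are the
digits of the orbit of c.  It is the distribution function of the conformal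
measure, v(1) = 1 and lam v(c) = d_0(c) + v(c').  As c |-> c' expands by at
most 2 and v is contracted by 1/lam, v is Hölder continuous with exponent
s = ln lam / ln 2 (cdf_hoelder).  For another hole [b,1], the maps c |-> c' of
a and b differ by at most 2|a-b|, so along the b-orbit of 1 the relation
lam v(c) = d_0(c) + v(c') fails by O(|a-b|^s) only.  Summing up, the digit
series of b at 1/lam equals 1 + O(|a-b|^s), whereas it is 1 at 1/lam_b; its
terms are monotone and the first one is the identity function, whence
|1/lam - 1/lam_b| = O(|a-b|^s) (growth_compare). *)

(** * Convergent series *)

Section has_sum.
Context {R : realType}.
Implicit Types (u v : nat -> R) (l q A : R).

Definition has_sum u l := series u @ \oo --> l.

Lemma has_sum_unique u l l' : has_sum u l -> has_sum u l' -> l = l'.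
Proof. by move=> h h'; apply: (cvg_unique _ h h'). Qed.

Lemma has_sum_lim u : cvgn (series u) -> has_sum u (limn (series u)).
Proof. by []. Qed.

Lemma has_sum_ext u v l : u =1 v -> has_sum u l -> has_sum v l.
Proof. by move=> /funext ->. Qed.

Lemma has_sumD u v l l' : has_sum u l -> has_sum v l' -> has_sum (fun n => u n + v n) (l + l').
Proof.
move=> h h'; rewrite /has_sum.
have -> : series (fun n => u n + v n) = series u + series v.
  by apply/funext => n; rewrite /series /= big_split.
exact: cvgD.
Qed.

Lemma has_sumZ k u l : has_sum u l -> has_sum (fun n => k * u n) (k * l).
Proof.
move=> h; rewrite /has_sum.
have -> : series (fun n => k * u n) = (fun n => k * series u n).
  by apply/funext => n; rewrite /series /= mulr_sumr.
by apply: cvgM => //; exact: cvg_cst.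
Qed.

Lemma has_sumN u l : has_sum u l -> has_sum (fun n => - u n) (- l).
Proof.
move=> h; have := has_sumZ (k:=-1) h; rewrite mulN1r; apply: has_sum_ext => n; by rewrite mulN1r.
Qed.

Lemma has_sumB u v l l' : has_sum u l -> has_sum v l' -> has_sum (fun n => u n - v n) (l - l').
Proof. by move=> h /has_sumN h'; exact: has_sumD. Qed.

Lemma has_sum_shift u l : has_sum (fun n => u n.+1) l -> has_sum u (u 0%N + l).
Proof.
move=> h; rewrite /has_sum -(cvg_shiftS (series u)).
have -> : (fun n => series u n.+1) = (fun n => u 0%N + series (fun n => u n.+1) n).
  by apply/funext => n; rewrite /series /= big_nat_recl.
by apply: cvgD => //; exact: cvg_cst.
Qed.

Lemma has_sum_unshift u l : has_sum u l -> has_sum (fun n => u n.+1) (l - u 0%N).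
Proof.
move=> h; rewrite /has_sum.
have -> : series (fun n => u n.+1) = (fun n => series u n.+1 - u 0%N).
  by apply/funext => n; rewrite /series /= big_nat_recl // addrC addKr.
apply: cvgB; last exact: cvg_cst.
by rewrite (cvg_shiftS (series u)).
Qed.

Lemma has_sum_le u v l l' : (forall n, u n <= v n) -> has_sum u l -> has_sum v l' -> l <= l'.
Proof.
move=> uv h h'; apply: (ler_cvg_to h h'); apply: nearW => n.
by rewrite /series /=; apply: ler_sum.
Qed.

Lemma has_sum0 : has_sum (fun=> 0) 0.
Proof.
rewrite /has_sum; have -> : series (fun=> 0 : R) = fun=> 0.
  by apply/funext => n; rewrite /series /= big1.
exact: cvg_cst.
Qed.

Lemma has_sum_ge0 u l : (forall n, 0 <= u n) -> has_sum u l -> 0 <= l.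
Proof. by move=> u0; apply: has_sum_le has_sum0. Qed.

Lemma has_sum_partial u l n : (forall n, 0 <= u n) -> has_sum u l ->
  \sum_(0 <= k < n) u k <= l.
Proof.
move=> u0 h; apply: (cvgr_to_ge h).
near=> m; rewrite /series /=.
have nm : (n <= m)%N by near: m; exact: nbhs_infty_ge.
by rewrite [leRHS](big_cat_nat _ nm) //= lerDl sumr_ge0.
Unshelve. all: by end_near. Qed.

Lemma has_sum_geo A q : 0 <= q < 1 -> has_sum (fun n => A * q ^+ n) (A / (1 - q)).
Proof.
move=> /andP[q0 q1]; have := @cvg_geometric_series R A q.
by rewrite ger0_norm//; apply.
Qed.

Lemma has_sum_dom u A q : 0 <= q < 1 -> (forall n, `|u n| <= A * q ^+ n) ->
  has_sum u (limn (series u)).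
Proof.
move=> q01 uA; apply: has_sum_lim; apply: normed_cvg.
apply: (@series_le_cvg _ _ (fun n => A * q ^+ n)) => //=.
- by move=> n; exact: le_trans (uA n).
- by apply/cvg_ex; exists (A / (1 - q)); exact: has_sum_geo.
Qed.

(** The common bound for all series below: their terms are dominated by a geometric
progression of ratio 1/lam, or of ratio lam/|z| for the resolvent at z. *)
Lemma has_sum_dom_le u l A q : 0 <= q < 1 -> (forall n, `|u n| <= A * q ^+ n) ->
  has_sum u l -> `|l| <= A / (1 - q).
Proof.
move=> q01 uA ul; rewrite ler_norml; apply/andP; split.
  apply: has_sum_le (has_sumN (has_sum_geo (A:=A) q01)) ul => n.
  by have := uA n; rewrite ler_norml => /andP[].
apply: has_sum_le ul (has_sum_geo (A:=A) q01) => n.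
by have := uA n; rewrite ler_norml => /andP[].
Qed.

End has_sum.

(* Convergence unfolds to a product, whose variables would become implicit arguments. *)
Arguments has_sum_unique {R u l l'} _ _.
Arguments has_sum_lim {R u} _.
Arguments has_sum_ext {R u v l} _ _.
Arguments has_sumD {R u v l l'} _ _.
Arguments has_sumZ {R} k {u l} _.
Arguments has_sumN {R u l} _.
Arguments has_sumB {R u v l l'} _ _.
Arguments has_sum_shift {R u l} _.
Arguments has_sum_unshift {R u l} _.
Arguments has_sum_le {R u v l l'} _ _ _.
Arguments has_sum0 {R}.
Arguments has_sum_ge0 {R u l} _ _.
Arguments has_sum_partial {R u l} n _ _.
Arguments has_sum_geo {R} A {q} _.
Arguments has_sum_dom {R u A q} _ _.
Arguments has_sum_dom_le {R u l A q} _ _ _.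

(** * The root of a digit series *)

Section digit_root.
Context {R : realType}.
Implicit Types (x y r : R).

(** With exprn_lipschitz this bounds the derivative of every partial sum of a digit
series on [0,r] by one constant, the derivative of 1/(1-x) at r. *)
Lemma sum_arith_geo r n : 0 <= r < 1 ->
  \sum_(0 <= k < n) k.+1%:R * r ^+ k <= (1 - r) ^- 2.
Proof.
move=> /andP[r0 r1].
have rp : 0 < 1 - r by rewrite subr_gt0.
rewrite -[leRHS]mul1r ler_pdivlMr ?exprn_gt0//.
suff -> : (\sum_(0 <= k < n) k.+1%:R * r ^+ k) * (1 - r) ^+ 2
    = 1 - r ^+ n - n%:R * r ^+ n * (1 - r).
  by rewrite -addrA -opprD gerBl addr_ge0// ?exprn_ge0// !mulr_ge0// ?exprn_ge0// ltW.
elim: n => [|n IH]; first by rewrite big_geq// expr0; ring.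
rewrite big_nat_recr//= mulrDl IH (exprS r n) -natr1; ring.
Qed.

Lemma exprn_lipschitz x y r n : 0 <= x -> x <= y -> y <= r ->
  y ^+ n.+1 - x ^+ n.+1 <= (y - x) * (n.+1%:R * r ^+ n).
Proof.
move=> x0 xy yr; have y0 := le_trans x0 xy; have r0 := le_trans y0 yr.
elim: n => [|n IH]; first by rewrite !expr1 expr0 !mulr1.
have -> : y ^+ n.+2 - x ^+ n.+2 = y * (y ^+ n.+1 - x ^+ n.+1) + (y - x) * x ^+ n.+1.
  by rewrite !(exprS _ n.+1); ring.
have -> : (y - x) * (n.+2%:R * r ^+ n.+1) =
    r * ((y - x) * (n.+1%:R * r ^+ n)) + (y - x) * r ^+ n.+1.
  by rewrite -(natr1 n.+1) !(exprS r n); ring.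
apply: lerD; last first.
  by rewrite ler_wpM2l ?subr_ge0// lerXn2r// ?nnegrE// (le_trans xy).
apply: (@le_trans _ _ (y * ((y - x) * (n.+1%:R * r ^+ n)))).
  by rewrite ler_wpM2l.
by rewrite ler_wpM2r// !mulr_ge0// ?subr_ge0// exprn_ge0.
Qed.

Variable d : nat -> R.
Hypothesis d01 : forall k, 0 <= d k <= 1.

Let d0 k : 0 <= d k. Proof. by have /andP[] := d01 k. Qed.
Let d1 k : d k <= 1. Proof. by have /andP[] := d01 k. Qed.

Let P n x := \sum_(0 <= k < n) d k * x ^+ k.+1.

Let P_lip n x y r : 0 <= x -> x <= y -> y <= r -> r < 1 ->
  P n y <= P n x + (y - x) * (1 - r) ^- 2.
Proof.
move=> x0 xy yr r1; have r0 := le_trans (le_trans x0 xy) yr.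
rewrite -lerBlDl /P -sumrB.
apply: (@le_trans _ _ ((y - x) * \sum_(0 <= k < n) k.+1%:R * r ^+ k)); last first.
  by rewrite ler_wpM2l ?subr_ge0// sum_arith_geo// r0.
rewrite mulr_sumr; apply: ler_sum => k _; rewrite -mulrBr.
apply: le_trans (exprn_lipschitz k x0 xy yr).
by rewrite ler_piMl// subr_ge0 lerXn2r// nnegrE// (le_trans x0).
Qed.

(** The partial sums are Lipschitz on [0,r] for r < 1, with a constant independent of
their length, so the supremum of the points where all of them are at most 1 solves the
equation.  Two digits equal to 1 keep this supremum away from 1; as no digit exceeds 1,
it is at least 1/2. *)
Lemma digit_root m : d 0%N = 1 -> d m.+1 = 1 ->
  exists x, 1 / 2 <= x < 1 /\ has_sum (fun k => d k * x ^+ k.+1) 1.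
Proof.
move=> dz dm.
(* For 1 - x < t, Bernoulli's inequality gives x + x^(m+2) > 1, so that the digits 0 and
   m+1 alone push the sum above 1. *)
pose t : R := (m.+4%:R)^-1.
have t0 : 0 < t by rewrite invr_gt0.
have tm : t * m.+4%:R = 1 by rewrite mulVf.
have t4 : t <= 1 / 4.
  by rewrite /t div1r lef_pV2 ?posrE// ler_nat.
pose r := 1 - t.
pose E := [set x : R | 0 <= x <= 1 /\ forall n, P n x <= 1].
have Eh : E (1 / 2).
  split; first by apply/andP; split; lra.
  move=> n; suff : P n (1 / 2) <= 1 - (1 / 2) ^+ n.
    by move/le_trans; apply; rewrite gerBl exprn_ge0//; lra.
  elim: n => [|n IH]; first by rewrite /P big_geq// expr0 subrr.
  rewrite /P big_nat_recr//= -/(P n _).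
  have := d1 n; have h : 0 <= (1 / 2 : R) ^+ n by rewrite exprn_ge0//; lra.
  rewrite exprS; nra.
have Er x : E x -> x <= r.
  move=> [/andP[x0 x1] /(_ m.+2)]; apply: contraTT; rewrite -!ltNge => rx.
  rewrite /P big_nat_recr//= big_nat_recl//= dz dm expr1 !mul1r.
  apply: (@lt_le_trans _ _ (x + x ^+ m.+2)); last first.
    by rewrite lerD2r lerDl sumr_ge0// => k _; rewrite mulr_ge0// exprn_ge0.
  have := @exprn_lipschitz x 1 1 m.+1 x0 x1 (lexx _).
  rewrite !expr1n mulr1.
  have mm : m.+2%:R = m.+4%:R - 2 :> R by rewrite -[m.+4]addn2 natrD; ring.
  rewrite mm; have : 0 < m.+2%:R :> R by rewrite ltr0n.
  rewrite mm => m2.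
  have : (1 - x) * (m.+4%:R - 2) < t * (m.+4%:R - 2).
    by rewrite ltr_pM2r//; move: rx; rewrite /r; lra.
  move: rx; rewrite /r; lra.
have hE : has_sup E by split; [exists (1/2) | exists r => x /Er].
pose s := sup E.
have s_ge : 1 / 2 <= s by apply: ub_le_sup => //; case: hE.
have s_le : s <= r by apply: ge_sup; [case: hE | move=> x /Er].
pose r' := (1 + r) / 2.
have r'1 : r' < 1 by rewrite /r' /r; lra.
have rr' : r < r' by rewrite /r' /r; lra.
pose K := (1 - r') ^- 2.
have K0 : 0 < K by rewrite invr_gt0 exprn_gt0// subr_gt0.
have Ps n : P n s <= 1.
  apply/ler_addgt0Pr => e e0.
  have [x Ex xs] := sup_adherent (divr_gt0 e0 K0) hE.
  have xs' : x <= s by apply: ub_le_sup => //; case: hE.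
  have [/andP[x0 _] /(_ n) Px] := Ex.
  apply: le_trans (P_lip n x0 xs' _ r'1) _; first by rewrite (le_trans s_le)// ltW.
  apply: lerD => //; rewrite -/K -ler_pdivlMr//.
  by move: xs; rewrite -/s; lra.
have s01 : 0 <= s < 1 by apply/andP; split; [lra|rewrite (le_lt_trans s_le)// (lt_trans rr')].
have dom n : `|d n * s ^+ n.+1| <= 1 * s ^+ n.
  rewrite ger0_norm; last by rewrite mulr_ge0// exprn_ge0//; case/andP: s01.
  apply: ler_pM => //; first by rewrite exprn_ge0//; case/andP: s01.
  by rewrite exprS ler_piMl ?exprn_ge0//; case/andP: s01 => // _ /ltW.
have [l Sl] : exists l : R, has_sum (fun n => d n * s ^+ n.+1) l.
  by eexists; exact: has_sum_dom s01 dom.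
have Pl n : P n s <= l.
  by apply: (@has_sum_partial _ (fun k => d k * s ^+ k.+1)) => // k; rewrite mulr_ge0// exprn_ge0//; case/andP: s01.
exists s; split; first by rewrite s_ge; case/andP: s01.
suff <- : l = 1 by [].
apply/eqP; rewrite eq_le; apply/andP; split.
  by apply: (cvgr_to_le Sl); apply: nearW => n; exact: Ps.
rewrite leNgt; apply/negP => l1.
(* If the sum at s were below 1, the Lipschitz bound would leave room for a larger point. *)
pose y := Num.min r' (s + (1 - l) / K).
have sy : s < y by rewrite lt_min (le_lt_trans s_le)//= ltrDl divr_gt0// subr_gt0.
have : E y.
  have s0 : 0 <= s by case/andP: s01.
  have yr : y <= r' by rewrite ge_min lexx.
  split; first by rewrite (le_trans s0 (ltW sy)) (le_trans yr)// ltW.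
  move=> n; apply: le_trans (P_lip n s0 (ltW sy) yr r'1) _.
  rewrite -lerBrDl -/K -ler_pdivlMr//.
  have : y <= s + (1 - l) / K by rewrite ge_min lexx orbT.
  have : (1 - l) / K <= (1 - P n s) / K.
    by apply: ler_wpM2r; [rewrite invr_ge0 ltW | have := Pl n; lra].
  lra.
move=> Ey; have : y <= s by apply: ub_le_sup => //; case: hE.
by rewrite leNgt sy.
Qed.

End digit_root.

(** * The orbit of 1, the eigenvalue and its eigenfunction *)

Section orbit.
Context {R : realType}.
Implicit Types (a b c x q : R) (u v : R -> R).

(** The right end of the image under T of the last piece of (0,c) outside the hole [a,1]:
of (0,c) itself if c <= 1/2, and of (1/2, min(c,a)) otherwise. *)
Definition next_end a c : R := if c <= 1 / 2 then 2 * c else 2 * Num.min c a - 1.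

Definition end_orbit a c k := iter k (next_end a) c.

Definition digit a c k : R := (1 / 2 < end_orbit a c k)%R%:R.

(** The exponential growth rate of the open system, as the reciprocal of a root of the
digit series of the orbit of 1.  The bounds on lam make the series converge and give
ln lam / ln 2 <= 1. *)
Definition growth_rate a (lam : R) := [/\ 1 < lam, lam <= 2 &
  has_sum (fun k => digit a 1 k * lam^-1 ^+ k.+1) 1].

Lemma digit01 a c k : 0 <= digit a c k <= 1.
Proof. by rewrite /digit; case: (_ < _); rewrite !(ler01, lexx). Qed.

Lemma digit_next_end a c k : digit a (next_end a c) k = digit a c k.+1.
Proof. by rewrite /digit /end_orbit iterSr. Qed.

Lemma next_end_itv a c : 1 / 2 < a < 1 -> 0 < c <= 1 -> 0 < next_end a c <= 1.
Proof.
move=> /andP[a0 a1] /andP[c0 c1]; rewrite /next_end; have [ch|ch] := leP c (1 / 2).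
  by apply/andP; split; lra.
by have [ca|ac] := leP c a; apply/andP; split; lra.
Qed.

Lemma end_orbit_itv a c k : 1 / 2 < a < 1 -> 0 < c <= 1 -> 0 < end_orbit a c k <= 1.
Proof. by move=> ha hc; elim: k => //= k IH; exact: next_end_itv. Qed.

(** As long as the digits are 0 the orbit is doubled at each step, so it leaves (0,1/2]. *)
Lemma digit_recur a c : 1 / 2 < a < 1 -> 0 < c <= 1 -> exists k, digit a c k = 1.
Proof.
move=> ha /andP[c0 c1]; apply: contrapT => nk.
have h k : end_orbit a c k <= 1 / 2.
  rewrite leNgt; apply/negP => hk; apply: nk; exists k; by rewrite /digit hk.
have e k : end_orbit a c k = 2 ^+ k * c.
  elim: k => [|k IH]; first by rewrite expr0 mul1r.
  by rewrite /end_orbit iterS -/(end_orbit a c k) /next_end h IH exprS mulrA.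
pose n := Num.truncn (c^-1).
have := h n.+1; rewrite e leNgt; case/negP.
have n1 : c^-1 < n.+1%:R by apply: truncnS_gt.
have : (n.+1%:R : R) < 2 ^+ n.+1 by rewrite -natrX ltr_nat ltn_expl.
move=> /(lt_trans n1); rewrite -(ltr_pM2r c0) mulVf ?gt_eqF//; lra.
Qed.

Lemma growth_rate_ex a : 1 / 2 < a < 1 -> exists lam, growth_rate a lam.
Proof.
move=> ha; have h1 : 0 < (1 : R) <= 1 by rewrite ltr01 lexx.
have [m hm] := digit_recur ha (next_end_itv ha h1).
have d0 : digit a 1 0 = 1.
  by rewrite /digit /end_orbit /=; have -> : 1 / 2 < 1 :> R by lra.
have [x [/andP[x0 x1] hx]] := digit_root (digit01 a 1) d0 (esym (etrans (esym hm) (digit_next_end _ _ _))).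
have xp : 0 < x by lra.
exists x^-1; split.
- by rewrite invf_gt1.
- by rewrite -[2]invrK lef_pV2 ?posrE// -[2^-1]mul1r.
- by rewrite invrK.
Qed.

Definition step (c x : R) : R := (x < c)%R%:R.

(** The transfer operator on real functions; the operator on complex functions acts as
this one on real and imaginary parts. *)
Definition rtransfer a u : R -> R :=
  fun x => u (x / 2) + \1_(`]0, a[%classic) ((1 + x) / 2) * u ((1 + x) / 2).

Lemma rtransferE a u x : 0 <= x ->
  rtransfer a u x = u (x / 2) + ((1 + x) / 2 < a)%R%:R * u ((1 + x) / 2).
Proof.
move=> x0; rewrite /rtransfer indicE mem_setE in_itv /=.
by have -> : 0 < (1 + x) / 2 by lra.
Qed.

(** If c > 1/2 the first inverse branch takes [0,1) into (0,c) and contributes the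
constant 1; the other branch, or the first one if c <= 1/2, contributes a step at the
next end. *)
Lemma rtransfer_step a c x : 0 < c <= 1 -> 0 <= x < 1 ->
  rtransfer a (step c) x = digit a c 0 + step (next_end a c) x.
Proof.
move=> /andP[c0 c1] /andP[x0 x1]; rewrite rtransferE// /step /digit /end_orbit /= /next_end -natrM mulnb.
have [ch|ch] := leP c (1 / 2).
  have -> : (x / 2 < c) = (x < 2 * c) by apply/idP/idP; lra.
  have -> : ((1 + x) / 2 < c) = false by apply/negP; lra.
  by rewrite andbF add0r addr0.
have -> : x / 2 < c by lra.
congr (1 + _%:R); congr nat_of_bool.
by have [ca|ac] := leP c a; apply/idP/idP; lra.
Qed.

Lemma branches_co x : 0 <= x < 1 -> (0 <= x / 2 < 1) /\ (0 <= (1 + x) / 2 < 1).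
Proof. by move=> /andP[? ?]; split; apply/andP; split; lra. Qed.

Lemma rtransfer_le a u v : (forall x, 0 <= x < 1 -> u x <= v x) ->
  forall x, 0 <= x < 1 -> rtransfer a u x <= rtransfer a v x.
Proof.
move=> uv x x01; have [h1 h2] := branches_co x01.
by rewrite /rtransfer; apply: lerD; [exact: uv | rewrite ler_wpM2l// ?uv// indicE].
Qed.

Lemma iter_rtransfer_le a u v n : (forall x, 0 <= x < 1 -> u x <= v x) ->
  forall x, 0 <= x < 1 -> iter n (rtransfer a) u x <= iter n (rtransfer a) v x.
Proof. by move=> uv; elim: n => //= n IH; exact: rtransfer_le. Qed.

Lemma rtransfer_eq a u v : (forall x, 0 <= x < 1 -> u x = v x) ->
  forall x, 0 <= x < 1 -> rtransfer a u x = rtransfer a v x.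
Proof.
move=> uv x x01; have [h1 h2] := branches_co x01; by rewrite /rtransfer !uv.
Qed.

Lemma rtransferD a u v : rtransfer a (fun x => u x + v x) = fun x => rtransfer a u x + rtransfer a v x.
Proof. by apply/funext => x; rewrite /rtransfer; ring. Qed.

Lemma rtransferZ a k u : rtransfer a (fun x => k * u x) = fun x => k * rtransfer a u x.
Proof. by apply/funext => x; rewrite /rtransfer; ring. Qed.

Lemma iter_rtransferD a u v n :
  iter n (rtransfer a) (fun x => u x + v x) = fun x => iter n (rtransfer a) u x + iter n (rtransfer a) v x.
Proof. by elim: n => //= n ->; rewrite rtransferD. Qed.

Lemma iter_rtransferZ a k u n :
  iter n (rtransfer a) (fun x => k * u x) = fun x => k * iter n (rtransfer a) u x.
Proof. by elim: n => //= n ->; rewrite rtransferZ. Qed.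

Lemma has_sum_rtransfer a (w : nat -> R -> R) u x :
  has_sum (w ^~ (x / 2)) (u (x / 2)) -> has_sum (w ^~ ((1 + x) / 2)) (u ((1 + x) / 2)) ->
  has_sum (fun k => rtransfer a (w k) x) (rtransfer a u x).
Proof. by move=> h1 h2; apply: has_sumD => //; exact: has_sumZ. Qed.

End orbit.

Section eigenfunction.
Context {R : realType} (a lam : R).
Hypothesis ha : 1 / 2 < a < 1.
Hypothesis hlam : growth_rate a lam.

Let q := lam^-1.

Lemma lam_gt0 : 0 < lam. Proof. by case: hlam => h _ _; apply: lt_trans h. Qed.
Lemma q_itv : 0 <= q < 1.
Proof. by rewrite /q invr_ge0 ltW ?lam_gt0//= invf_lt1 ?lam_gt0//; case: hlam. Qed.
Let q0 : 0 <= q. Proof. by case/andP: q_itv. Qed.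
Let q1 : q < 1. Proof. by case/andP: q_itv. Qed.
Let lamq : lam * q = 1. Proof. by rewrite /q mulfV// gt_eqF// lam_gt0. Qed.

Let c_ k := end_orbit a 1 k.

Lemma end_orbit1_itv k : 0 < c_ k <= 1.
Proof. by apply: end_orbit_itv => //; rewrite ltr01 lexx. Qed.

(** A positive combination of nonincreasing steps; the step at c_0 = 1 makes it at least 1
on [0,1), so that it can be compared with the constant 1 in both directions. *)
Definition eigf x : R := limn (series (fun k => q ^+ k * step (c_ k) x)).

Let step01 (c x : R) : 0 <= step c x <= 1.
Proof. by rewrite /step; case: (_ < _); rewrite !(ler01, lexx). Qed.

Lemma eigf_has_sum x : has_sum (fun k => q ^+ k * step (c_ k) x) (eigf x).
Proof.
apply: (@has_sum_dom _ _ 1 q q_itv) => n; rewrite mul1r.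
have /andP[h0 h1] := step01 (c_ n) x.
by rewrite ger0_norm ?mulr_ge0 ?exprn_ge0// ler_piMr// exprn_ge0.
Qed.

Arguments eigf_has_sum : clear implicits.

Lemma eigf_le x y : x <= y -> eigf y <= eigf x.
Proof.
move=> xy; apply: has_sum_le (eigf_has_sum y) (eigf_has_sum x) => n.
rewrite ler_wpM2l ?exprn_ge0// /step.
case: ltP => [yc|_]; first by rewrite (le_lt_trans xy yc).
by rewrite ler0n.
Qed.

Lemma eigf_ge0 x : 0 <= eigf x.
Proof.
apply: has_sum_ge0 (eigf_has_sum x) => n.
by have /andP[h0 h1] := step01 (c_ n) x; rewrite mulr_ge0// exprn_ge0.
Qed.

Lemma eigf0 : eigf 0 = (1 - q)^-1.
Proof.
apply: (has_sum_unique (eigf_has_sum 0)); rewrite -[X in has_sum _ X]mul1r.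
apply: (has_sum_ext _ (has_sum_geo 1 q_itv)) => n; rewrite mul1r /step.
by have /andP[-> _] := end_orbit1_itv n; rewrite mulr1.
Qed.

Lemma eigf_ge1 x : x < 1 -> 1 <= eigf x.
Proof.
move=> x1; have e1 : step (c_ 0) x = 1 by rewrite /step /c_ /end_orbit /= x1.
have -> : 1 = \sum_(0 <= k < 1) q ^+ k * step (c_ k) x.
  by rewrite big_nat1 e1 expr0 mul1r.
apply: has_sum_partial (eigf_has_sum x) => n.
by have /andP[h0 h1] := step01 (c_ n) x; rewrite mulr_ge0// exprn_ge0.
Qed.

(** Applying the operator shifts the sum by one index and adds the constant
sum_k d_k lam^-k = lam, which is lam times the missing term e_{c_0} = 1. *)
Lemma rtransfer_eigf x : 0 <= x < 1 -> rtransfer a eigf x = lam * eigf x.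
Proof.
move=> x01; have [h1 h2] := branches_co x01.
have h := @has_sum_rtransfer R a (fun k y => q ^+ k * step (c_ k) y) eigf x
  (eigf_has_sum _) (eigf_has_sum _).
apply: (has_sum_unique h).
have x1 : x < 1 by case/andP: x01.
have e1 : step (c_ 0) x = 1 by rewrite /step /c_ /end_orbit /= x1.
have s1 := has_sum_unshift (eigf_has_sum x).
have [_ _ s2] := hlam.
have -> : lam * eigf x = lam * (1 + (eigf x - q ^+ 0 * step (c_ 0) x)).
  by rewrite e1 expr0 mul1r addrC subrK.
apply: (has_sum_ext _ (has_sumZ lam (has_sumD s2 s1))) => k.
rewrite -/q rtransferZ rtransfer_step ?end_orbit1_itv// exprS.
rewrite /digit /c_ /end_orbit /= -[RHS]mul1r; move: (_%:R) (step _ _) => u v; rewrite -lamq; ring.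
Qed.

Lemma iter_rtransfer_eigf n x : 0 <= x < 1 -> iter n (rtransfer a) eigf x = lam ^+ n * eigf x.
Proof.
elim: n x => [|n IH] x x01; first by rewrite mul1r.
by rewrite iterS (@rtransfer_eq _ a _ (fun x => lam ^+ n * eigf x))// rtransferZ rtransfer_eigf// exprSr mulrA.
Qed.

(** The value of the eigenfunction at 0. *)
Definition eigf_max : R := (1 - q)^-1.

Lemma eigf_max_gt0 : 0 < eigf_max. Proof. by rewrite invr_gt0 subr_gt0. Qed.

(** The operator is positive and 1 <= f on [0,1), so the iterates of 1 stay below
lam^n f. *)
Lemma iter_rtransfer1_le n x : 0 <= x < 1 -> iter n (rtransfer a) (cst 1) x <= eigf_max * lam ^+ n.
Proof.
move=> x01; apply: (@le_trans _ _ (iter n (rtransfer a) eigf x)).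
  by apply: iter_rtransfer_le => // y /andP[_ y1]; exact: eigf_ge1.
rewrite iter_rtransfer_eigf// mulrC; apply: ler_wpM2r; first by rewrite exprn_ge0// ltW// lam_gt0.
by rewrite /eigf_max -eigf0; apply: eigf_le; case/andP: x01.
Qed.

(** Positivity again, from f <= f(0) on [0,1). *)
Lemma iter_rtransfer1_ge n : lam ^+ n <= iter n (rtransfer a) (cst 1) 0.
Proof.
have z01 : 0 <= (0 : R) < 1 by rewrite lexx ltr01.
have : iter n (rtransfer a) eigf 0 <= iter n (rtransfer a) (fun x => eigf_max * cst 1 x) 0.
  apply: iter_rtransfer_le => // y /andP[y0 _]; rewrite mulr1 /eigf_max -eigf0; exact: eigf_le.
by rewrite iter_rtransfer_eigf// iter_rtransferZ eigf0 -/eigf_max mulrC ler_pM2l ?eigf_max_gt0.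
Qed.

End eigenfunction.

Arguments eigf_has_sum {R a lam} _ x.

(** * The distribution function of the conformal measure *)

Section le_of_geo.
Context {R : realType}.
(** Inequalities are proved below with an error q^n that is improved by induction. *)
Lemma le_of_geo (x y B q : R) : 0 <= q < 1 -> (forall n, x <= y + B * q ^+ n) -> x <= y.
Proof.
move=> /andP[q0 q1] h.
have hc : (fun n : nat => y + B * q ^+ n) @ \oo --> y + B * 0.
  apply: cvgD; first exact: cvg_cst.
  apply: cvgM; first exact: cvg_cst.
  by apply: cvg_expr; rewrite ger0_norm.
rewrite mulr0 addr0 in hc.
by apply: (cvgr_to_ge hc); exact: nearW.
Qed.
End le_of_geo.

Section conformal.
Context {R : realType} (a lam : R).
Hypothesis ha : 1 / 2 < a < 1.
Hypothesis hlam : growth_rate a lam.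

Let q := lam^-1.
Let q01 : 0 <= q < 1. Proof. exact: q_itv hlam. Qed.
Let q0 : 0 <= q. Proof. by case/andP: q01. Qed.
Let lam0 : 0 < lam. Proof. exact: lam_gt0 hlam. Qed.
Let lamq : lam * q = 1. Proof. by rewrite /q mulfV// gt_eqF. Qed.

(** The distribution function of the conformal measure, the eigenmeasure of the dual
operator: for c in [0,1], cdf c is the measure of (0,c). *)
Definition cdf c : R := limn (series (fun k => digit a c k * q ^+ k.+1)).

Lemma digit_dom b c n : `|digit b c n * q ^+ n.+1| <= 1 * q ^+ n.
Proof.
have /andP[d0 d1] := digit01 b c n.
rewrite ger0_norm ?mulr_ge0 ?exprn_ge0// ler_pM ?exprn_ge0//.
by rewrite exprS ler_piMl ?exprn_ge0//; case/andP: q01 => _ /ltW.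
Qed.

Lemma cdf_has_sum c : has_sum (fun k => digit a c k * q ^+ k.+1) (cdf c).
Proof. exact: has_sum_dom q01 (digit_dom a c). Qed.
Arguments cdf_has_sum : clear implicits.

Lemma cdf_ge0 c : 0 <= cdf c.
Proof.
apply: has_sum_ge0 (cdf_has_sum c) => n; have /andP[d0 d1] := digit01 a c n.
by rewrite mulr_ge0// exprn_ge0.
Qed.

Lemma cdf_le_eigf_max c : cdf c <= eigf_max lam.
Proof.
have := has_sum_dom_le q01 (digit_dom a c) (cdf_has_sum c).
by rewrite div1r; apply: le_trans; exact: ler_norm.
Qed.

Lemma cdf_next_end c : cdf c = q * (digit a c 0 + cdf (next_end a c)).
Proof.
apply: (has_sum_unique (cdf_has_sum c)).
rewrite mulrDr -[q * digit _ _ _](_ : digit a c 0 * q ^+ 1 = _); last by rewrite expr1 mulrC.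
apply: (has_sum_shift (u := fun k => digit a c k * q ^+ k.+1)).
apply: (has_sum_ext _ (has_sumZ q (cdf_has_sum (next_end a c)))) => k.
by rewrite digit_next_end (exprS q k.+1); ring.
Qed.

Lemma cdf1 : cdf 1 = 1.
Proof. by apply: (has_sum_unique (cdf_has_sum 1)); case: hlam. Qed.

Lemma cdf_low c : c <= 1 / 2 -> cdf c = q * cdf (2 * c).
Proof. by move=> ch; rewrite cdf_next_end /digit /end_orbit /= /next_end ch ltNge ch add0r. Qed.

Lemma cdf_high c : 1 / 2 < c -> cdf c = q * (1 + cdf (2 * Num.min c a - 1)).
Proof. by move=> ch; rewrite cdf_next_end /digit /end_orbit /= /next_end ch leNgt ch. Qed.

(** Any two values differ by at most a constant, and the functional equation contracts
a possible violation of monotonicity by 1/lam when the two points lie on the same side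
of 1/2.  When 1/2 separates them, cdf (1/2) = 1/lam separates the values up to a
contracted error. *)
Lemma cdf_le c c' : 0 <= c -> c <= c' -> c' <= 1 -> cdf c <= cdf c'.
Proof.
move=> h1 h2 h3; apply: (@le_of_geo _ _ _ (eigf_max lam) q q01) => n.
elim: n c c' h1 h2 h3 => [|n IH] c c' c0 cc' c1.
  by rewrite expr0 mulr1 (le_trans (cdf_le_eigf_max c))// lerDr cdf_ge0.
rewrite exprS mulrCA.
have /andP[a0 a1] := ha.
have [ch'|ch'] := leP c' (1 / 2).
  rewrite (cdf_low ch') (@cdf_low c) ?(le_trans cc')// -mulrDr ler_wpM2l//.
  by apply: IH; lra.
have [ch|ch] := leP c (1 / 2).
  rewrite (cdf_low ch) (cdf_high ch') -mulrDr ler_wpM2l//.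
  apply: (@le_trans _ _ (cdf 1 + eigf_max lam * q ^+ n)); first by apply: IH; lra.
  by rewrite cdf1 lerD2r lerDl cdf_ge0.
rewrite (cdf_high ch) (cdf_high ch') -mulrDr ler_wpM2l// -addrA lerD2l.
by apply: IH; have [? | ?] := leP c a; have [? | ?] := leP c' a; lra.
Qed.

Lemma cdf_le1 c : 0 <= c <= 1 -> cdf c <= 1.
Proof. by move=> /andP[c0 c1]; rewrite -cdf1 cdf_le. Qed.

(** Doubling n times brings c into [0,1] at the cost of a factor lam^n. *)
Lemma cdf_near0 n c : 0 <= c -> c * 2 ^+ n <= 1 -> cdf c <= q ^+ n.
Proof.
elim: n c => [|n IH] c c0; first by rewrite mulr1 => c1; apply: cdf_le1; rewrite c0.
rewrite exprS => c1; have hn : 1 <= 2 ^+ n :> R by apply: exprn_ege1; lra.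
rewrite cdf_low; last by nra.
by rewrite exprS ler_wpM2l//; apply: IH; lra.
Qed.

(** Near 1 the map c |-> c' either expands by 2 or, beyond a, identifies all points. *)
Lemma cdf_near1 n c : 0 <= c <= 1 -> (1 - c) * 2 ^+ n <= 1 -> 1 - cdf c <= q ^+ n.
Proof.
elim: n c => [|n IH] c /andP[c0 c1].
  by move=> _; rewrite expr0 gerBl cdf_ge0.
have /andP[a0 a1] := ha.
rewrite exprS => c2; have hn : 1 <= 2 ^+ n :> R by apply: exprn_ege1; lra.
have [ch|ch] := leP c (1 / 2).
  case: n hn c2 IH => [|n] hn c2 IH; last first.
    have hn' : 1 <= 2 ^+ n :> R by apply: exprn_ege1; lra.
    by rewrite exprS in c2; nra.
  have -> : c = 1 / 2 by move: c2; rewrite expr0; lra.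
  by rewrite cdf_low// mulrCA mulfV// mulr1 cdf1 mulr1 expr1 /q; have [h1 h2 _] := hlam;
    rewrite lerBlDr -mulr2n -mulr_natl -ler_pdivrMr ?invr_gt0// invrK mul1r.
rewrite exprS -cdf1 (@cdf_high 1); last lra.
rewrite (cdf_high ch) -mulrBr ler_wpM2l//.
rewrite (min_idPr (ltW a1)).
have [ca|ac] := leP c a; last by rewrite subrr exprn_ge0.
have h : 1 - cdf (2 * c - 1) <= q ^+ n.
  by apply: IH; [lra|move: c2; set w := 2 ^+ n; lra].
have : cdf (2 * a - 1) <= 1 by apply: cdf_le1; lra.
lra.
Qed.

(** Two points on the same side of 1/2 are handled by induction.  If 1/2 lies between
them, the two parts of the increment are transported by the map next to 0 and next to
1, where the one-sided estimates give lam^-n each: hence the factor 2. *)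
Lemma cdf_scale n c c' : 0 <= c -> c <= c' -> c' <= 1 -> (c' - c) * 2 ^+ n <= 1 ->
  cdf c' - cdf c <= 2 * q ^+ n.
Proof.
have /andP[a0 a1] := ha.
elim: n c c' => [|n IH] c c' c0 cc' c1.
  move=> _; have := cdf_ge0 c; have : cdf c' <= 1 by apply: cdf_le1; lra.
  rewrite expr0; lra.
rewrite !exprS => h; have hn : 1 <= 2 ^+ n :> R by apply: exprn_ege1; lra.
have [ch'|ch'] := leP c' (1 / 2).
  rewrite (cdf_low ch') (@cdf_low c) ?(le_trans cc')// -mulrBr mulrCA ler_wpM2l//.
  by apply: IH; lra.
have [ch|ch] := leP c (1 / 2); last first.
  rewrite (cdf_high ch) (cdf_high ch') -mulrBr mulrCA ler_wpM2l//.
  rewrite opprD addrACA subrr add0r.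
  have [? | ?] := leP c' a; have [? | ?] := leP c a; first by apply: IH; lra.
  - by exfalso; lra.
  - by apply: IH; try lra; nra.
  - by rewrite subrr mulr_ge0// exprn_ge0.
have k1 : cdf (2 * Num.min c' a - 1) <= q ^+ n.
  have [? | ?] := leP c' a; apply: cdf_near0; try lra; nra.
have k2 : 1 - cdf (2 * c) <= q ^+ n by apply: cdf_near1; try lra; nra.
rewrite (cdf_low ch) (cdf_high ch') -mulrBr mulrCA ler_wpM2l//; lra.
Qed.

End conformal.

(** * Comparison of the growth rates of two holes *)

Section compare.
Context {R : realType} (a lam : R).
Hypothesis ha : 1 / 2 < a < 1.
Hypothesis hlam : growth_rate a lam.

Let q := lam^-1.
Let q01 : 0 <= q < 1. Proof. exact: q_itv hlam. Qed.
Let q0 : 0 <= q. Proof. by case/andP: q01. Qed.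
Let lam0 : 0 < lam. Proof. exact: lam_gt0 hlam. Qed.
Let lamq : lam * q = 1. Proof. by rewrite /q mulfV// gt_eqF. Qed.
Let s := ln lam / ln 2.

Lemma dyadic_scale (t : R) : 0 < t <= 1 -> exists n, t * 2 ^+ n <= 1 < t * 2 ^+ n.+1.
Proof.
move=> /andP[t0 t1].
have ex : exists n, 1 < t * 2 ^+ n.
  exists (Num.truncn t^-1).+1; set m := (Num.truncn t^-1).+1.
  rewrite mulrC -ltr_pdivrMr// div1r (lt_trans (truncnS_gt _))//.
  by rewrite -natrX ltr_nat ltn_expl.
case: (ex_minnP ex) => -[|n] hn min; first by rewrite mulr1 ltNge t1 in hn.
exists n; rewrite hn andbT leNgt; apply/negP => /min; by rewrite ltnn.
Qed.

Lemma pow_scale (t : R) n : 0 < t -> 1 < t * 2 ^+ n -> q ^+ n <= t `^ s.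
Proof.
move=> t0 h; have ln2 : 0 < ln (2 : R) by rewrite ln_gt0// ltr1n.
have hl : 0 < ln lam by rewrite ln_gt0//; case: hlam.
have qp : 0 < q by rewrite invr_gt0.
rewrite -ler_ln ?posrE ?exprn_gt0 ?powR_gt0// lnXn// ln_powR /q lnV ?posrE//.
have : 0 <= ln (t * 2 ^+ n) by rewrite ln_ge0// ltW.
rewrite lnM ?posrE ?exprn_gt0// lnXn// => hh.
have -> : - ln lam *+ n = s * - (ln 2 *+ n).
  by rewrite mulrN mulrnAr /s mulfVK ?gt_eqF// mulNrn.
apply: ler_wpM2l; first by rewrite divr_ge0// ltW.
by rewrite lerNl -subr_ge0 opprK addrC.
Qed.

(** The scale estimate at n with |c - c'| close to 2^-n, since 2^s = lam. *)
Lemma cdf_hoelder c c' : 0 <= c <= 1 -> 0 <= c' <= 1 ->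
  `|cdf a lam c - cdf a lam c'| <= 4 * `|c - c'| `^ s.
Proof.
wlog cc' : c c' / c <= c'.
  move=> h hc hc'; have [cc'|cc'] := leP c c'; first exact: h.
  by rewrite distrC (distrC c); apply: h => //; exact: ltW.
move=> /andP[c0 c1] /andP[c0' c1'].
have [->|ne] := eqVneq c c'.
  by rewrite !subrr normr0 mulr_ge0// powR_ge0.
have t0 : 0 < c' - c by rewrite subr_gt0 lt_neqAle ne.
rewrite distrC ger0_norm ?subr_ge0 ?(cdf_le ha hlam)// (distrC c) gtr0_norm//.
have [|n /andP[h1 h2]] := @dyadic_scale (c' - c); first by rewrite t0/=; lra.
apply: le_trans (cdf_scale ha hlam c0 cc' c1' h1) _.
have := pow_scale t0 h2; rewrite exprS -/q.
have qh : 1 / 2 <= q.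
  by rewrite div1r /q lef_pV2 ?posrE//; case: hlam.
have := exprn_ge0 n q0.
nra.
Qed.

(** The functional equation of the hole a, evaluated along the orbit of 1 for the hole b,
has an error only where min(c,a) differs from min(c,b), and there it is controlled by
the Hölder continuity of cdf.  Multiplied by lam^-k and summed, the equations telescope
and compare the digit series of b at 1/lam with cdf 1 = 1. *)
Lemma growth_compare b lam' : 1 / 2 < b < 1 -> growth_rate b lam' ->
  `|q - lam'^-1| <= q / (1 - q) * (4 * (2 * `|a - b|) `^ s).
Proof.
move=> hb hlam'.
have /andP[a0 a1] := ha; have /andP[b0 b1] := hb.
set E := 4 * _.
have E0 : 0 <= E by rewrite mulr_ge0// powR_ge0.
have q1 : q < 1 by case/andP: q01.
have tauE c : 0 < c <= 1 -> `|cdf a lam (next_end a c) - cdf a lam (next_end b c)| <= E.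
  move=> hc; apply: le_trans (cdf_hoelder _ _) _.
  - by have /andP[h ->] := next_end_itv ha hc; rewrite ltW.
  - by have /andP[h ->] := next_end_itv hb hc; rewrite ltW.
  have s0 : 0 <= s.
    by rewrite /s divr_ge0// ln_ge0// ?ler1n//; case: hlam => /ltW.
  apply: ler_wpM2l => //; apply: ge0_ler_powR; rewrite ?nnegrE//.
  rewrite /next_end; case: ifP => _; first by rewrite subrr normr0 mulr_ge0.
  have -> : 2 * Num.min c a - 1 - (2 * Num.min c b - 1) = 2 * (Num.min c a - Num.min c b) by ring.
  rewrite normrM ger0_norm// ler_wpM2l//.
  have [?|?] := leP c a; have [?|?] := leP c b; rewrite ?subrr ?normr0// ler_norml;
    have := ler_norm (a - b); have := ler_norm (b - a); rewrite (distrC b); lra.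
pose c k := end_orbit b 1 k.
have hc k : 0 < c k <= 1 by apply: end_orbit_itv => //; rewrite ltr01 lexx.
have hc' k : 0 <= c k <= 1 by have /andP[/ltW -> ->] := hc k.
(* The functional equation of a along the b-orbit of 1, with its error. *)
have err k : `|cdf a lam (c k) - q * (digit b 1 k + cdf a lam (c k.+1))| <= q * E.
  have -> : cdf a lam (c k) - q * (digit b 1 k + cdf a lam (c k.+1)) =
     q * (cdf a lam (next_end a (c k)) - cdf a lam (next_end b (c k))).
    have -> : c k.+1 = next_end b (c k) by [].
    have -> : digit b 1 k = digit a (c k) 0 by [].
    rewrite {1}(cdf_next_end hlam) -/q; ring.
  by rewrite normrM ger0_norm// ler_wpM2l// tauE.
pose u k := q ^+ k * cdf a lam (c k).
have u_dom k : `|u k| <= 1 * q ^+ k.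
  rewrite /u ger0_norm ?mulr_ge0 ?exprn_ge0// ?(cdf_ge0 hlam)//.
  by rewrite [leRHS]mulrC ler_wpM2l ?exprn_ge0// (cdf_le1 ha hlam).
have hu := has_sum_dom q01 u_dom.
have hd := has_sum_dom q01 (digit_dom hlam b 1).
have h := has_sumB hu (has_sumD hd (has_sum_unshift hu)).
move: hd h; set U := limn (series u); set D := limn (series (fun n => _)) => hd h.
have D1 : `|1 - D| <= q / (1 - q) * E.
  have -> : 1 - D = U - (D + (U - u 0%N)).
    by rewrite /u expr0 mul1r /c /end_orbit /= (cdf1 hlam); ring.
  rewrite mulrAC; apply: (has_sum_dom_le q01 _ h) => k.
  have -> : u k - (digit b 1 k * q ^+ k.+1 + u k.+1) =
    q ^+ k * (cdf a lam (c k) - q * (digit b 1 k + cdf a lam (c k.+1))).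
    by rewrite /u exprS; ring.
  by rewrite normrM ger0_norm ?exprn_ge0// mulrC ler_wpM2r ?exprn_ge0// err.
apply: le_trans D1.
have [_ _ hd'] := hlam'.
have q0' : 0 <= lam'^-1 by have /andP[] := q_itv hlam'.
(* The digit series of b grows at least like its first term, the identity. *)
have key (x y X Y : R) : 0 <= x -> x <= y ->
   has_sum (fun k => digit b 1 k * x ^+ k.+1) X ->
   has_sum (fun k => digit b 1 k * y ^+ k.+1) Y -> y - x <= Y - X.
  move=> x0 xy hX hY.
  have -> : y - x = \sum_(0 <= k < 1) (digit b 1 k * y ^+ k.+1 - digit b 1 k * x ^+ k.+1).
    have h1 : 1 / 2 < 1 :> R by lra.
    by rewrite big_nat1 /digit /end_orbit /= h1 !mul1r !expr1.
  apply: (has_sum_partial _ _ (has_sumB hY hX)) => k.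
  have /andP[d0 d1] := digit01 b 1 k.
  by rewrite -mulrBr mulr_ge0// subr_ge0 lerXn2r// nnegrE// (le_trans x0).
have [qq|/ltW qq] := leP q lam'^-1.
  rewrite distrC ger0_norm ?subr_ge0//; apply: le_trans (key _ _ _ _ q0 qq hd hd') _.
  exact: ler_norm.
rewrite ger0_norm ?subr_ge0//; apply: le_trans (key _ _ _ _ q0' qq hd' hd) _.
by rewrite distrC ler_norm.
Qed.

Lemma ln_growth_compare b lam' : 1 / 2 < b < 1 -> growth_rate b lam' ->
  `|ln lam - ln lam'| <= 16 * q / (1 - q) * `|a - b| `^ s.
Proof.
move=> hb hlam'; have h := growth_compare hb hlam'.
have s1 : s <= 1.
  have [l1 l2 _] := hlam; rewrite /s ler_pdivrMr ?ln_gt0 ?ltr1n// mul1r.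
  by rewrite ler_ln ?posrE.
have q1 : q < 1 by case/andP: q01.
have h2 : (2 * `|a - b|) `^ s <= 2 * `|a - b| `^ s.
  rewrite powRM// ler_wpM2r ?powR_ge0//.
  by rewrite -[leRHS]powRr1// ler_powR// ler1n.
have lnle (x y : R) : 1 < x <= 2 -> 1 < y <= 2 -> ln x - ln y <= 2 * `|x^-1 - y^-1|.
  move=> /andP[x1 x2] /andP[y1 y2]; have x0 := lt_trans ltr01 x1; have y0 := lt_trans ltr01 y1.
  rewrite -ln_div ?posrE//; apply: le_trans (_ : x / y - 1 <= _).
    have xy0 : 0 < x / y by rewrite divr_gt0.
    by have := @le_ln1Dx _ (x / y - 1); rewrite addrCA subrr addr0; apply; rewrite ltrBrDl subrr.
  have -> : x / y - 1 = x * (y^-1 - x^-1) by rewrite mulrBr mulfV// gt_eqF.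
  apply: (@le_trans _ _ (x * `|x^-1 - y^-1|)); last by apply: ler_wpM2r.
  by apply: ler_wpM2l; [exact: ltW | rewrite distrC ler_norm].
have l12 : 1 < lam <= 2 by case: hlam => -> ->.
have l12' : 1 < lam' <= 2 by case: hlam' => -> ->.
apply: (@le_trans _ _ (2 * `|q - lam'^-1|)).
  rewrite ler_norml lerNl opprB lnle// andbT.
  by rewrite distrC lnle.
apply: (@le_trans _ _ (2 * (q / (1 - q) * (4 * (2 * `|a - b| `^ s))))).
  rewrite ler_wpM2l//; apply: le_trans h _; apply: ler_wpM2l; last by rewrite ler_wpM2l.
  by rewrite divr_ge0// subr_ge0 ltW.
by rewrite le_eqVlt; apply/orP; left; apply/eqP; ring.
Qed.

End compare.

(** * Cylinders and topological entropy *)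

Section words.
Context {R : realType} (b : R).
Hypothesis hb : 1 / 2 < b < 1.

Let H : set R := `[b, 1]%classic.

(** The two sets of the partition restricted to the complement of the hole. *)
Definition letter (i : bool) : set R :=
  if i then `]2^-1, b[%classic else `]0, 2^-1[%classic.

Fixpoint cyl (w : seq bool) : set R :=
  if w is i :: w' then letter i `&` Tpreimage (cyl w') else setT.

Fixpoint words n : seq (seq bool) :=
  if n is n'.+1 then map (cons false) (words n') ++ map (cons true) (words n')
  else [:: [::]].

Lemma mem_words n w : (w \in words n) = (size w == n).
Proof.
elim: n w => [|n IH] [|i w] //=.
  rewrite mem_cat; apply/negbTE/negP => /orP[] /mapP[] //.
rewrite mem_cat eqSS -IH; case: i.
  rewrite [X in X || _](_ : _ = false) /=; last by apply/negbTE/negP => /mapP[].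
  by rewrite mem_map// => ? ? [].
rewrite orbC [X in X || _](_ : _ = false) /=; last by apply/negbTE/negP => /mapP[].
by rewrite mem_map// => ? ? [].
Qed.

Lemma words_uniq n : uniq (words n).
Proof.
elim: n => //= n IH; rewrite cat_uniq !map_inj_uniq ?IH => [|? ? [] //|? ? [] //].
rewrite andbT /=; apply/hasPn => w /mapP[w' _ ->]; by apply/negP => /mapP[].
Qed.

Lemma ZHP B : ZH H B <-> exists i, B = letter i.
Proof.
have /andP[b0 b1] := hb; rewrite div1r in b0.
have E0 : `]0, 2^-1[%classic `&` (`[0, 1]%classic `\` H) = letter false.
  apply/seteqP; split => x; rewrite /letter /H /= !in_itv/=; first by case.
  move=> hx; split => //; split; first by apply/andP; split; lra.
  by apply/negP; lra.
have E1 : `]2^-1, 1[%classic `&` (`[0, 1]%classic `\` H) = letter true.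
  apply/seteqP; split => x; rewrite /letter /H /= !in_itv/=.
    by move=> [hx [h1 /negP h2]]; lra.
  move=> hx; split; first by lra.
  by split; [lra | apply/negP; lra].
split.
  by move=> [_ [Z [->|->] ->]]; [exists false|exists true].
move=> [i ->]; split.
  case: i; rewrite /letter.
    by exists ((2^-1 + b) / 2); rewrite /= in_itv/=; apply/andP; split; lra.
  by exists (2^-1 / 2); rewrite /= in_itv/=; apply/andP; split; lra.
case: i; first by exists `]2^-1, 1[%classic; [right|].
by exists `]0, 2^-1[%classic; [left|].
Qed.

Lemma letter_dom i : letter i `<=` `]0, 2^-1[%classic `|` `]2^-1, 1[%classic.
Proof.
have /andP[b0 b1] := hb.
case: i => x; rewrite /letter /= in_itv /= => hx; [right|by left].
by rewrite in_itv /=; lra.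
Qed.

(** Both letters lie in the domain of T, so the domain condition built into the partial
preimage survives even when the intersection on the right is empty. *)
Lemma bigcap_Tpreimage i (Z : nat -> set R) n : Z 0%N = letter i ->
  \bigcap_(k in `I_n.+1) iter k Tpreimage (Z k) =
  letter i `&` Tpreimage (\bigcap_(k in `I_n) iter k Tpreimage (Z k.+1)).
Proof.
move=> Z0; apply/seteqP; split => x.
  move=> h; have h0 : letter i x by rewrite -Z0; apply: (h 0%N).
  split => //; split; first exact: letter_dom h0.
  by move=> k /= kn; have [] := h k.+1 kn.
move=> [h0 [hD h]] [|k] kn /=; first by rewrite Z0.
by split => //; apply: (h k).
Qed.

(** Replaces the families of sets in the definition of the refined partition by words,
which can be enumerated. *)
Lemma ZHnE n : ZHn H n = [set B | B !=set0 /\ exists2 w, size w = n & B = cyl w].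
Proof.
suff h B : (exists2 Z : nat -> set R, (forall i, (i < n)%N -> ZH H (Z i)) &
    B = \bigcap_(i in `I_n) iter i Tpreimage (Z i)) <->
    (exists2 w, size w = n & B = cyl w).
  by apply/seteqP; split => B [B0 /h hB].
elim: n B => [|n IH] B; split.
- by move=> [Z _ ->]; exists [::] => //=; rewrite bigcap_mkord big_ord0.
- by move=> [[|//] _ ->]; exists (fun=> set0) => //; rewrite bigcap_mkord big_ord0.
- move=> [Z hZ ->]; have /ZHP[i Zi] := hZ 0%N isT.
  have /IH[w sw ew] : exists2 Z' : nat -> set R, (forall i, (i < n)%N -> ZH H (Z' i)) &
      \bigcap_(k in `I_n) iter k Tpreimage (Z k.+1) =
      \bigcap_(i in `I_n) iter i Tpreimage (Z' i).
    by exists (fun k => Z k.+1) => // k kn; apply: hZ.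
  by exists (i :: w); rewrite /= ?sw// (bigcap_Tpreimage _ Zi) ew.
- move=> [[//|i w] /= [sw] ->].
  have /IH[Z hZ eZ] : exists2 w', size w' = n & cyl w = cyl w' by exists w.
  pose Z' k := if k is k'.+1 then Z k' else letter i.
  exists Z'; last by rewrite (@bigcap_Tpreimage i)// eZ.
  by case=> [|k] kn; [apply/ZHP; exists i | apply: hZ].
Qed.

Lemma letter_inj i j x : letter i x -> letter j x -> i = j.
Proof. by case: i; case: j => //; rewrite /letter /= !in_itv /=; lra. Qed.

(** A point determines its itinerary, so distinct words with nonempty cylinders give
distinct members of the refined partition. *)
Lemma cyl_inj w w' x : size w = size w' -> cyl w x -> cyl w' x -> w = w'.
Proof.
elim: w w' x => [|i w IH] [|j w'] //= x [sw] [h1 [_ h2]] [h3 [_ h4]].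
by rewrite (letter_inj h1 h3) (IH _ _ sw h2 h4).
Qed.

(** Counting the cylinders that meet (0,c), rather than all nonempty ones, is what makes
a recursion on the length of words possible. *)
Definition meets c w := `[< (cyl w `&` `]0, c[%classic) !=set0 >].

Lemma card_ZHn n : #|` fset_set (ZHn H n)|%fset = count (meets 1) (words n).
Proof.
have cyl01 w x : (0 < size w)%N -> cyl w x -> 0 < x < 1.
  case: w => // i w _ [/letter_dom]; rewrite /= !in_itv /= => h _.
  by case: h => h; lra.
pose s := map cyl [seq w <- words n | meets 1 w].
have -> : ZHn H n = [set` [fset B in s]%fset].
  rewrite ZHnE; apply/seteqP; split => B /=; rewrite !inE.
    move=> [[x Bx] [w sw ew]]; apply/mapP; exists w => //.
    rewrite mem_filter mem_words sw eqxx andbT; apply/asboolP.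
    case: w => [|i w] in sw ew *; last first.
      by exists x; split; [rewrite -ew | rewrite /= in_itv /= (cyl01 (i :: w))// -ew].
    by exists 2^-1; split => //=; rewrite in_itv /=; lra.
  move=> /mapP[w]; rewrite mem_filter mem_words => /andP[/asboolP[x [wx _]] /eqP sw] ->.
  by split; [exists x | exists w].
rewrite set_fsetK card_fseq undup_id.
  by rewrite size_map size_filter.
rewrite map_inj_in_uniq ?filter_uniq ?words_uniq// => w w'.
rewrite !mem_filter !mem_words => /andP[/asboolP[x [wx _]] /eqP sw] /andP[_ /eqP sw'] e.
by apply: (@cyl_inj _ _ x); rewrite ?sw ?sw'// -e.
Qed.

Lemma doubling_low (x : R) : 0 < x < 2^-1 -> doubling x = 2 * x.
Proof.
move=> h; rewrite /doubling; have -> : Num.floor (2 * x) = 0.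
  by apply: floor_def; rewrite add0r; apply/andP; split; lra.
by rewrite subr0.
Qed.

Lemma doubling_high (x : R) : 2^-1 < x < 1 -> doubling x = 2 * x - 1.
Proof.
move=> h; rewrite /doubling; have -> // : Num.floor (2 * x) = 1.
by apply: floor_def; rewrite -[(1 + 1)%R]/(2%:Z); apply/andP; split; lra.
Qed.

(** T maps the part of (0,c) in (0,1/2) onto (0, min(2c,1)). *)
Lemma meets_false c w : 0 < c <= 1 -> meets c (false :: w) = meets (Num.min (2 * c) 1) w.
Proof.
move=> /andP[c0 c1]; apply/asboolP/asboolP => -[x].
  rewrite /= !in_itv /= => -[[hx [_ hw]] /andP[_ xc]].
  have {}hw : cyl w (2 * x) by rewrite -doubling_low.
  exists (2 * x); split => //=; rewrite in_itv /=.
  by have [?|?] := leP (2 * c) 1; lra.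
move=> [hw]; rewrite /= in_itv /= => hx.
have hx' : 0 < x / 2 < 2^-1 by move: hx; have [?|?] := leP (2 * c) 1; lra.
exists (x / 2); rewrite /= !in_itv /=; split; last first.
  by move: hx; have [?|?] := leP (2 * c) 1; lra.
split => //; split; first by left; rewrite /= in_itv.
by rewrite /preimage /= doubling_low// mulrC mulfVK.
Qed.

(** T maps the part of (0,c) in (1/2,b) onto (0, 2 min(c,b) - 1), if it is nonempty. *)
Lemma meets_true c w : 0 < c <= 1 ->
  meets c (true :: w) = (1 / 2 < c) && meets (2 * Num.min c b - 1) w.
Proof.
have /andP[b0 b1] := hb.
move=> /andP[c0 c1]; apply/asboolP/andP.
  move=> [x] /=; rewrite !in_itv /= => -[[hx [_ hw]] /andP[_ xc]].
  have {}hw : cyl w (2 * x - 1) by rewrite -doubling_high//; lra.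
  split; first by lra.
  apply/asboolP; exists (2 * x - 1); split => //=; rewrite in_itv /=.
  by have [?|?] := leP c b; lra.
move=> [ch /asboolP[x [hw]]]; rewrite /= in_itv /= => hx.
have hx' : 2^-1 < (1 + x) / 2 < b by move: hx; have [?|?] := leP c b; lra.
exists ((1 + x) / 2); rewrite /= !in_itv /=; split; last first.
  by move: hx; have [?|?] := leP c b; lra.
split => //; split; first by right; rewrite /= in_itv /=; lra.
rewrite /preimage /= doubling_high; last by lra.
by have -> : 2 * ((1 + x) / 2) - 1 = x by field.
Qed.

(** The number of cylinders meeting (0,c) obeys the same recursion in c as the value at
0 of the iterates of the transfer operator on the step at c. *)
Lemma count_iter_rtransfer n c : 0 < c <= 1 ->
  (count (meets c) (words n))%:R = iter n (rtransfer b) (step c) 0.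
Proof.
elim: n c => [|n IH] c hc; have /andP[c0 c1] := hc.
  rewrite /= /step c0 addn0; congr (nat_of_bool _)%:R; apply/asboolP.
  by exists (c / 2); rewrite /= in_itv /=; split => //; lra.
have z01 : 0 <= (0 : R) < 1 by rewrite lexx ltr01.
have h01 : 0 < (1 : R) <= 1 by rewrite lexx ltr01.
rewrite /= count_cat !count_map natrD -iterS iterSr.
have -> : iter n (rtransfer b) (rtransfer b (step c)) 0 =
  digit b c 0 * iter n (rtransfer b) (step 1) 0 + iter n (rtransfer b) (step (next_end b c)) 0.
  have -> : digit b c 0 * iter n (rtransfer b) (step 1) 0 + iter n (rtransfer b) (step (next_end b c)) 0 =
    iter n (rtransfer b) (fun x => digit b c 0 * step 1 x + step (next_end b c) x) 0.
    by rewrite iter_rtransferD iter_rtransferZ.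
  apply/eqP; rewrite eq_le; apply/andP; split; apply: iter_rtransfer_le => // x x01;
    by rewrite rtransfer_step// /step; case/andP: x01 => _ ->; rewrite mulr1.
rewrite -!IH ?next_end_itv//.
rewrite (eq_count (a2 := meets (Num.min (2 * c) 1))); last first.
  by move=> w /=; rewrite meets_false.
rewrite [X in _ + X%:R](eq_count (a2 := fun w => (1 / 2 < c) && meets (2 * Num.min c b - 1) w)); last first.
  by move=> w /=; rewrite meets_true.
rewrite /digit /end_orbit /= /next_end.
have [ch|ch] := leP c (1 / 2).
  rewrite (min_idPl _); last by lra.
  by rewrite mul0r add0r [X in _ + X%:R](eq_count (a2 := pred0))// count_pred0 addr0.
rewrite (min_idPr _); last by lra.
by rewrite mul1r.
Qed.

(** The number of cylinders lies between lam^n and a constant multiple of lam^n. *)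
Lemma htop_growth lam : growth_rate b lam -> htop H = ln lam.
Proof.
move=> hlam; have [lam1 lam2 _] := hlam; have lam0 := lam_gt0 hlam.
have h01 : 0 < (1 : R) <= 1 by rewrite lexx ltr01.
have z01 : 0 <= (0 : R) < 1 by rewrite lexx ltr01.
pose N n : R := (#|` fset_set (ZHn H n)|%fset)%:R.
have NE n : N n = iter n (rtransfer b) (cst 1) 0.
  rewrite /N card_ZHn count_iter_rtransfer//; apply/eqP; rewrite eq_le.
  by apply/andP; split; apply: iter_rtransfer_le => // x /andP[_ x1]; rewrite /step x1.
have Nlo n : lam ^+ n <= N n by rewrite NE; apply: iter_rtransfer1_ge.
have Nhi n : N n <= eigf_max lam * lam ^+ n by rewrite NE; apply: iter_rtransfer1_le.
have C0 : 0 < eigf_max lam := eigf_max_gt0 hlam.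
have Np n : 0 < N n by apply: lt_le_trans (Nlo n); rewrite exprn_gt0.
have Llo n : ln lam *+ n <= ln (N n).
  by rewrite -lnXn// ler_ln ?posrE ?exprn_gt0.
have Lhi n : ln (N n) <= ln (eigf_max lam) + ln lam *+ n.
  by rewrite -lnXn// -lnM ?posrE ?exprn_gt0// ler_ln ?posrE// mulr_gt0// exprn_gt0.
have l0 : 0 <= ln lam by rewrite ln_ge0// ltW.
have lpE n : log_plus (N n) = ln (N n).
  by rewrite /log_plus (max_idPr _)// (le_trans _ (Llo n))// mulrn_wge0.
rewrite /htop; apply: cvg_lim => //.
rewrite -(cvg_shiftS (fun n => n%:R^-1 * log_plus (N n))).
(* The index is shifted by one, so that no division by 0 occurs. *)
have hc : (fun n : nat => ln (eigf_max lam) * n.+1%:R^-1 + ln lam) @ \oo --> ln lam.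
  rewrite -[X in _ --> X]add0r; apply: cvgD; last exact: cvg_cst.
  rewrite -[X in _ --> X](mulr0 (ln (eigf_max lam))).
  by apply: cvgM; [exact: cvg_cst | exact: cvg_harmonic].
apply: squeeze_cvgr (cvg_cst (ln lam)) hc; apply: nearW => n.
rewrite /= -/(N n.+1) lpE; have n0 : 0 < n.+1%:R :> R by rewrite ltr0n.
rewrite mulrC; apply/andP; split.
  by rewrite ler_pdivlMr// mulr_natr.
rewrite ler_pdivrMr// mulrDl mulfVK ?gt_eqF// mulr_natr; exact: Lhi.
Qed.

End words.

(** * Hölder continuity of the entropy *)

Section hoelder_bound.
Context {R : realType} (a : R).
Hypothesis ha : 1 / 2 < a < 1.

Let X : set R^o := `]1 / 2, 1[%classic.
Let h : R^o -> R^o := fun b => htop `[b, 1]%classic.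

(** The exponent ln lam / ln 2 itself is admissible, since the Hölder quotient is bounded
on all of (1/2,1) and not only near a. *)
Lemma htop_hoelder lam : growth_rate a lam ->
  hoelder_exponents X h a (h a / ln 2).
Proof.
move=> hlam; have [lam1 lam2 _] := hlam; have lam0 := lam_gt0 hlam.
have ln2 : 0 < ln (2 : R) by rewrite ln_gt0// ltr1n.
rewrite {2}/h (htop_growth ha hlam); set s := _ / _.
have s0 : 0 < s by rewrite divr_gt0// ln_gt0.
split.
  by rewrite s0 /s ler_pdivrMr// mul1r ler_ln ?posrE.
pose C := 16 * lam^-1 / (1 - lam^-1).
apply: (@le_lt_trans _ _ C%:E); last exact: ltry.
rewrite limf_esupE; apply: ge_ereal_inf; pose V := [set b : R^o | X b /\ b != a].
exists (ereal_sup [set (mdist (h b) (h a) / mdist b (a : R^o) `^ s)%:E | b in V]).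
  exists V => //.
    have : nbhs (a : R^o) (fun x => x != a -> X x -> V x).
      by apply: (filterS _ filterT) => x _ xa Xx; split.
    by apply: filterS.
apply: ge_ereal_sup => _ [b [hb ba] <-]; rewrite lee_fin.
have {}hb : 1 / 2 < b < 1 by move: hb; rewrite /X /= in_itv.
have [lam' hlam'] := growth_rate_ex hb.
rewrite /mdist /= /h (htop_growth ha hlam) (htop_growth hb hlam').
rewrite ler_pdivrMr ?powR_gt0 ?normr_gt0 ?subr_eq0 1?eq_sym//.
exact: ln_growth_compare.
Qed.

Lemma htop_hoelder_ge : hoelder_continuous_at X h a /\ h a / ln 2 <= Hoel X h a.
Proof.
have [lam hlam] := growth_rate_ex ha; have hs := htop_hoelder hlam.
split; first by exists (h a / ln 2).
apply: ub_le_sup => //; exists 1 => x [/andP[_ x1] _]; exact: x1.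
Qed.

End hoelder_bound.

(** * The cone of nonincreasing functions and Neumann series *)

Section cone.
Context {R : realType}.
Implicit Types (p u v : R -> R) (K x y k a : R).

(** Nonnegative nonincreasing functions on [0,1], for which the bound K on the value at
0 is at once a bound on the supremum and on the total variation. *)
Definition cone K p := [/\ (forall x y, 0 <= x -> x <= y -> y <= 1 -> p y <= p x),
  0 <= p 1 & p 0 <= K].

(** Real functions of bounded variation on [0,1]; the least K over the versions
of u is equivalent to the BV norm. *)
Definition cone_diff K u := exists p r, [/\ cone K p, cone K r &
  forall x, 0 <= x <= 1 -> u x = p x - r x].

Lemma cone_itv K p x : cone K p -> 0 <= x <= 1 -> 0 <= p x <= K.
Proof.
move=> [h p1 p0] /andP[x0 x1]; apply/andP; split.
  by apply: le_trans p1 _; exact: h.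
by apply: le_trans p0; exact: h.
Qed.

Lemma cone_K0 K p : cone K p -> 0 <= K.
Proof. by move=> hp; have /andP[h1 h2] := @cone_itv K p 0 hp (introT andP (conj (lexx _) ler01)); apply: le_trans h2. Qed.

Lemma cone_diff_K0 K u : cone_diff K u -> 0 <= K.
Proof. by move=> [p [r [/cone_K0]]]. Qed.

Lemma cone_diff_bound K u x : cone_diff K u -> 0 <= x <= 1 -> `|u x| <= K.
Proof.
move=> [p [r [hp hr e]]] x01; rewrite e//; have /andP[p0 p1] := cone_itv hp x01.
have /andP[r0 r1] := cone_itv hr x01; rewrite ler_norml; apply/andP; split; lra.
Qed.

Lemma coneD K K' p p' : cone K p -> cone K' p' -> cone (K + K') (fun x => p x + p' x).
Proof.
move=> [h1 h2 h3] [h1' h2' h3']; split; [|exact: addr_ge0|exact: lerD].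
by move=> x y x0 xy y1; apply: lerD; [exact: h1|exact: h1'].
Qed.

Lemma coneZ K p k : 0 <= k -> cone K p -> cone (k * K) (fun x => k * p x).
Proof.
move=> k0 [h1 h2 h3]; split; [|exact: mulr_ge0|exact: ler_wpM2l].
by move=> x y x0 xy y1; apply: ler_wpM2l => //; exact: h1.
Qed.

Lemma cone_diffD K K' u v : cone_diff K u -> cone_diff K' v -> cone_diff (K + K') (fun x => u x + v x).
Proof.
move=> [p [r [hp hr e]]] [p' [r' [hp' hr' e']]].
exists (fun x => p x + p' x), (fun x => r x + r' x); split; try exact: coneD.
by move=> x x01; rewrite e// e'//; ring.
Qed.

Lemma cone_diffN K u : cone_diff K u -> cone_diff K (fun x => - u x).
Proof.
by move=> [p [r [hp hr e]]]; exists r, p; split => // x x01; rewrite e// opprB.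
Qed.

Lemma cone_diffZ K u k : cone_diff K u -> cone_diff (`|k| * K) (fun x => k * u x).
Proof.
move=> h; have [k0|k0] := leP 0 k.
  have [p [r [hp hr e]]] := h; exists (fun x => k * p x), (fun x => k * r x).
  rewrite ger0_norm//; split; try exact: coneZ.
  by move=> x x01; rewrite e// mulrBr.
have [p [r [hp hr e]]] := cone_diffN h; exists (fun x => - k * p x), (fun x => - k * r x).
rewrite ltr0_norm//; split; try by apply: coneZ; rewrite // oppr_ge0 ltW.
by move=> x x01; rewrite -mulrBr -e// mulrNN.
Qed.

Lemma cone0 : cone 0 (fun=> 0).
Proof. by split. Qed.

Lemma cone_diff0 : cone_diff 0 (fun=> 0).
Proof. by exists (fun=> 0), (fun=> 0); split; [exact: cone0|exact: cone0|move=> *; rewrite subr0]. Qed.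

Lemma cone_cone_diff K p : cone K p -> cone_diff K p.
Proof.
move=> h; exists p, (fun=> 0); split => //; last by move=> *; rewrite subr0.
by split=> //; exact: cone_K0 h.
Qed.

Lemma branches_cc x : 0 <= x <= 1 -> (0 <= x / 2 <= 1) /\ (0 <= (1 + x) / 2 <= 1).
Proof. by move=> /andP[? ?]; split; apply/andP; split; lra. Qed.

Lemma rtransfer_ceq a u v : (forall x, 0 <= x <= 1 -> u x = v x) ->
  forall x, 0 <= x <= 1 -> rtransfer a u x = rtransfer a v x.
Proof. by move=> uv x x01; have [h1 h2] := branches_cc x01; rewrite /rtransfer !uv. Qed.

Lemma iter_rtransfer_ceq a u v n : (forall x, 0 <= x <= 1 -> u x = v x) ->
  forall x, 0 <= x <= 1 -> iter n (rtransfer a) u x = iter n (rtransfer a) v x.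
Proof. by move=> uv; elim: n => //= n IH; exact: rtransfer_ceq. Qed.

(** The second inverse branch contributes a nonincreasing function cut to 0 beyond a
point, which is again nonincreasing because it is nonnegative. *)
Lemma cone_rtransfer a K p : cone K p -> cone (rtransfer a p 0) (rtransfer a p).
Proof.
move=> hp; have [h1 h2 h3] := hp; split => //.
  move=> x y x0 xy y1; have x1 := le_trans xy y1; have y0 := le_trans x0 xy.
  rewrite !rtransferE//; apply: lerD; first by apply: h1; lra.
  have [ya|ya] := ltP ((1 + y) / 2) a.
    have -> : (1 + x) / 2 < a by lra.
    by rewrite !mul1r; apply: h1; lra.
  rewrite mul0r mulr_ge0//.
  by have /andP[] : 0 <= p ((1 + x) / 2) <= K by apply: cone_itv => //; lra.
rewrite rtransferE//; apply: addr_ge0; last rewrite mulr_ge0//.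
  by have /andP[] : 0 <= p (1 / 2) <= K by apply: cone_itv => //; lra.
by have /andP[] : 0 <= p ((1 + 1) / 2) <= K by apply: cone_itv => //; lra.
Qed.

Lemma cone_le K K' p : p 0 <= K' -> cone K p -> cone K' p.
Proof. by move=> pK [h1 h2 h3]; split. Qed.

Section growth.
Variables (a lam : R).
Hypothesis ha : 1 / 2 < a < 1.
Hypothesis hlam : growth_rate a lam.
Let lam0 : 0 < lam. Proof. exact: lam_gt0 hlam. Qed.

(** Only the value at 0 has to be estimated, and there positivity compares p with K. *)
Lemma cone_iter_rtransfer K p n : cone K p -> cone (K * (eigf_max lam * lam ^+ n)) (iter n (rtransfer a) p).
Proof.
move=> hp.
have [K' hK'] : exists K', cone K' (iter n (rtransfer a) p).
  elim: n => [|n [K' IH]]; first by exists K.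
  by exists (rtransfer a (iter n (rtransfer a) p) 0); apply: cone_rtransfer IH.
apply: cone_le hK'.
have z01 : 0 <= (0 : R) < 1 by rewrite lexx ltr01.
apply: (@le_trans _ _ (iter n (rtransfer a) (fun x => K * cst 1 x) 0)).
  apply: iter_rtransfer_le => // x /andP[x0 x1]; rewrite mulr1.
  by have /andP[] : 0 <= p x <= K by apply: cone_itv; rewrite // x0 ltW.
by rewrite iter_rtransferZ ler_wpM2l ?(cone_K0 hp)//; exact: iter_rtransfer1_le.
Qed.

Lemma cone_diff_rtransfer K u : cone_diff K u -> cone_diff (K * (eigf_max lam * lam)) (rtransfer a u).
Proof.
move=> [p [r [hp hr e]]]; exists (rtransfer a p), (rtransfer a r).
have h1 := cone_iter_rtransfer 1 hp; have h2 := cone_iter_rtransfer 1 hr.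
split => // x x01; rewrite (rtransfer_ceq _ e)// /rtransfer; ring.
Qed.

Lemma cone_diff_iter_rtransfer K u n : cone_diff K u -> cone_diff (K * (eigf_max lam * lam ^+ n)) (iter n (rtransfer a) u).
Proof.
move=> [p [r [hp hr e]]]; exists (iter n (rtransfer a) p), (iter n (rtransfer a) r).
have h1 := cone_iter_rtransfer n hp; have h2 := cone_iter_rtransfer n hr.
split => // x x01; rewrite (iter_rtransfer_ceq _ _ e)//.
have -> : (fun x => p x - r x) = (fun x => p x + -1 * r x).
  by apply/funext => y; rewrite mulN1r.
by rewrite iter_rtransferD iter_rtransferZ mulN1r.
Qed.

(** Sums of iterates with arbitrary real coefficients: the real and imaginary parts of
the powers of 1/z are of this kind. *)
Definition neumann (th : nat -> R) u x : R :=
  limn (series (fun n => th n * iter n (rtransfer a) u x)).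

Variable rho : R.
Hypothesis rho0 : 0 <= rho.
Hypothesis rho1 : rho * lam < 1.

Let rl01 : 0 <= rho * lam < 1. Proof. by rewrite rho1 mulr_ge0// ltW. Qed.

Lemma neumann_dom A th K u x n : (forall n, `|th n| <= A * rho ^+ n) -> cone_diff K u ->
  0 <= x <= 1 -> `|th n * iter n (rtransfer a) u x| <= (A * (K * eigf_max lam)) * (rho * lam) ^+ n.
Proof.
move=> hth hu x01; rewrite normrM.
apply: (@le_trans _ _ (A * rho ^+ n * (K * (eigf_max lam * lam ^+ n)))).
  by apply: ler_pM => //; exact: cone_diff_bound (cone_diff_iter_rtransfer n hu) x01.
by rewrite exprMn le_eqVlt; apply/orP; left; apply/eqP; ring.
Qed.

Lemma neumann_has_sum A th K u x : (forall n, `|th n| <= A * rho ^+ n) -> cone_diff K u ->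
  0 <= x <= 1 -> has_sum (fun n => th n * iter n (rtransfer a) u x) (neumann th u x).
Proof.
by move=> hth hu x01; apply: (has_sum_dom rl01) => n; apply: neumann_dom hu x01.
Qed.
Arguments neumann_has_sum {A th K u x} _ _ _.

Lemma cone_neumann A th K p : (forall n, 0 <= th n <= A * rho ^+ n) -> cone K p ->
  cone (A * (K * eigf_max lam) / (1 - rho * lam)) (neumann th p).
Proof.
move=> hth hp.
have hth' n : `|th n| <= A * rho ^+ n by have /andP[? ?] := hth n; rewrite ger0_norm.
have th0 n : 0 <= th n by have /andP[] := hth n.
have hu := cone_cone_diff hp.
have h x (x01 : 0 <= x <= 1) := neumann_has_sum hth' hu x01.
have z01 : 0 <= (0 : R) <= 1 by rewrite lexx ler01.
have o01 : 0 <= (1 : R) <= 1 by rewrite lexx ler01.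
split.
- move=> x y x0 xy y1; have x01 : 0 <= x <= 1 by rewrite x0 (le_trans xy).
  have y01 : 0 <= y <= 1 by rewrite y1 (le_trans x0).
  apply: has_sum_le (h _ y01) (h _ x01) => n; apply: ler_wpM2l => //.
  by have [hh _ _] := cone_iter_rtransfer n hp; apply: hh.
- apply: has_sum_ge0 (h _ o01) => n; apply: mulr_ge0 => //.
  by have [_ hh _] := cone_iter_rtransfer n hp.
- apply: le_trans (ler_norm _) _.
  apply: (has_sum_dom_le rl01 _ (h _ z01)) => n; exact: neumann_dom hu z01.
Qed.

(** Positive and negative parts of the coefficients, combined with the two cone parts of
u, give four sums of iterates in the cone. *)
Lemma cone_diff_neumann A th K u : (forall n, `|th n| <= A * rho ^+ n) -> cone_diff K u ->
  cone_diff (2 * (A * (K * eigf_max lam) / (1 - rho * lam))) (neumann th u).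
Proof.
move=> hth [p [r [hp hr e]]].
pose thp n := Num.max (th n) 0; pose thn n := Num.max (- th n) 0.
have Ap n : 0 <= A * rho ^+ n := le_trans (normr_ge0 _) (hth n).
have hthp n : 0 <= thp n <= A * rho ^+ n.
  by rewrite le_max lexx orbT ge_max Ap andbT (le_trans _ (hth n))// ler_norm.
have hthn n : 0 <= thn n <= A * rho ^+ n.
  by rewrite le_max lexx orbT ge_max Ap andbT (le_trans _ (hth n))// -normrN ler_norm.
have thE n : th n = thp n - thn n.
  rewrite /thp /thn; have [h|h] := leP (th n) 0; have [h'|h'] := leP (- th n) 0; lra.
exists (fun x => neumann thp p x + neumann thn r x), (fun x => neumann thp r x + neumann thn p x).
have nn (t : nat -> R) : (forall n, 0 <= t n <= A * rho ^+ n) -> (forall n, `|t n| <= A * rho ^+ n).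
  by move=> ht n; have /andP[? ?] := ht n; rewrite ger0_norm.
split.
- by rewrite mulrDl mul1r; apply: coneD; apply: cone_neumann.
- by rewrite mulrDl mul1r; apply: coneD; apply: cone_neumann.
move=> x x01; have hu : cone_diff K u by exists p, r.
have hp' := cone_cone_diff hp; have hr' := cone_cone_diff hr.
apply: (has_sum_unique (neumann_has_sum hth hu x01)).
apply: (has_sum_ext _ (has_sumB (has_sumD (neumann_has_sum (nn _ hthp) hp' x01) (neumann_has_sum (nn _ hthn) hr' x01))
   (has_sumD (neumann_has_sum (nn _ hthp) hr' x01) (neumann_has_sum (nn _ hthn) hp' x01)))) => n.
rewrite thE (iter_rtransfer_ceq _ _ e)//.
have -> : (fun x => p x - r x) = (fun x => p x + -1 * r x).
  by apply/funext => y; rewrite mulN1r.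
rewrite iter_rtransferD iter_rtransferZ; ring.
Qed.

Lemma neumann_shift A th K u x : (forall n, `|th n| <= A * rho ^+ n) ->
  cone_diff K u -> 0 <= x <= 1 ->
  neumann th u x = th 0%N * u x + rtransfer a (neumann (fun n => th n.+1) u) x.
Proof.
move=> hth hu x01; have [h1 h2] := branches_cc x01.
have hth' n : `|th n.+1| <= A * rho * rho ^+ n by rewrite -mulrA -exprS.
apply: (has_sum_unique (neumann_has_sum hth hu x01)).
apply: (has_sum_shift (u := fun n => th n * iter n (rtransfer a) u x)).
have h := @has_sum_rtransfer R a (fun n y => th n.+1 * iter n (rtransfer a) u y)
  (neumann (fun n => th n.+1) u) x (neumann_has_sum hth' hu h1) (neumann_has_sum hth' hu h2).
by apply: (has_sum_ext _ h) => n; rewrite rtransferZ.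
Qed.

Lemma neumann_lin A A' th th' K u k k' x : (forall n, `|th n| <= A * rho ^+ n) ->
  (forall n, `|th' n| <= A' * rho ^+ n) -> cone_diff K u -> 0 <= x <= 1 ->
  neumann (fun n => k * th n + k' * th' n) u x = k * neumann th u x + k' * neumann th' u x.
Proof.
move=> hth hth' hu x01.
have h := has_sumD (has_sumZ k (neumann_has_sum hth hu x01)) (has_sumZ k' (neumann_has_sum hth' hu x01)).
have h' : has_sum (fun n => (k * th n + k' * th' n) * iter n (rtransfer a) u x)
   (k * neumann th u x + k' * neumann th' u x).
  by apply: (has_sum_ext _ h) => n; ring.
apply: (has_sum_unique _ h'); apply: has_sum_lim; apply/cvg_ex; eexists; exact: h'.
Qed.

End growth.
End cone.

(** * Differences of cone functions have bounded variation *)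

Section normc.
Context {R : realType}.
Implicit Types (x y : R) (z : R[i]).

Lemma ler_normc_sum x y : Normc.normc (x +i* y) <= `|x| + `|y|.
Proof.
rewrite /Normc.normc -[leRHS]ger0_norm ?addr_ge0// -sqrtr_sqr ler_sqrt ?sqr_ge0//.
by rewrite sqrrD !real_normK ?num_real// lerD2r lerDl mulrn_wge0// mulr_ge0.
Qed.

Lemma ler_Re_normc z : `|complex.Re z| <= Normc.normc z.
Proof. by case: z => x y; rewrite /= -sqrtr_sqr ler_sqrt ?addr_ge0 ?sqr_ge0// lerDl sqr_ge0. Qed.

Lemma ler_Im_normc z : `|complex.Im z| <= Normc.normc z.
Proof. by case: z => x y; rewrite /= -sqrtr_sqr ler_sqrt ?addr_ge0 ?sqr_ge0// lerDr sqr_ge0. Qed.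

Lemma normc_ge0 z : 0 <= Normc.normc z.
Proof. by apply: le_trans (ler_Re_normc z). Qed.

End normc.

Section bv.
Context {R : realType}.
Local Notation mu := (@lebesgue_measure R).
Local Notation II := (`[(0 : R), (1 : R)]%classic : set R).
Implicit Types (u v : R -> R) (f g : R -> R[i]) (K : R).

(** Increments dominated by those of a cone function telescope. *)
Lemma cvariation_le K p f s : cone K p ->
  (forall x y, 0 <= x -> x <= y -> y <= 1 -> Normc.normc (f y - f x) <= p x - p y) ->
  itv_partition 0 1 s -> cvariation 0 1 f s <= K.
Proof.
move=> [h p1 p0] up hs; rewrite /cvariation; set F := nth 1 (0 :: s).
have F0 n : (n < (size s).+1)%N -> 0 <= F n by move=> ns; exact: itv_partition_nth_ge hs.
have F1 n : (n < (size s).+1)%N -> F n <= 1 by move=> ns; exact: itv_partition_nth_le hs.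
apply: (@le_trans _ _ (\sum_(0 <= n < size s) (- (p \o F) n.+1 - - (p \o F) n))).
  rewrite !big_nat; apply: ler_sum => n /andP[_ ns] /=; rewrite opprK [leRHS]addrC; apply: up.
  - by apply: F0; exact: ltnW.
  - have [/(pathP 1) hp _] := hs; apply: ltW; exact: hp.
  - exact: F1.
rewrite (@telescope_sumr _ 0 (size s) (fun n => - (p \o F) n))//= opprK addrC.
apply: le_trans p0; rewrite /F /= gerBl; apply: le_trans p1 _.
by apply: h => //; [apply: F0|apply: F1].
Qed.

(** Monotonicity is assumed on [0,1] only, hence the extension by constants. *)
Lemma cone_measurable K p : cone K p -> measurable_fun II p.
Proof.
move=> [h _ _]; pose cl (x : R) := Num.max 0 (Num.min 1 x).
apply: (@eq_measurable_fun _ _ _ _ _ (p \o cl)).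
  move=> x; rewrite inE /= in_itv /= => /andP[x0 x1].
  by rewrite /cl (min_idPr x1) (max_idPr x0).
apply: nonincreasing_measurable => // x y xy /=; apply: h; rewrite /cl.
- by rewrite le_max lexx.
- by rewrite le_max2// le_min2.
- by rewrite ge_max ler01 ge_min lexx.
Qed.

Lemma cone_diff_measurable K u : cone_diff K u -> measurable_fun II u.
Proof.
move=> [p [r [hp hr e]]]; apply: (@eq_measurable_fun _ _ _ _ _ (p \- r)).
  by move=> x; rewrite inE /= in_itv /= => hx; rewrite e.
by apply: measurable_funB; [exact: cone_measurable hp|exact: cone_measurable hr].
Qed.

Lemma measurable_I : measurable (II).
Proof. exact: measurable_itv. Qed.

Lemma mu_I : mu II = 1%:E.
Proof. by rewrite lebesgue_measure_itv /= lte_fin ltr01 oppr0 adde0. Qed.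

Lemma normc_measurable (f : R -> R[i]) (D : set R) :
  measurable_fun D (fun x => complex.Re (f x)) ->
  measurable_fun D (fun x => complex.Im (f x)) ->
  measurable_fun D (fun x => Normc.normc (f x)).
Proof.
move=> h1 h2.
have -> : (fun x => Normc.normc (f x)) = (@Num.sqrt R) \o
    (fun x => complex.Re (f x) ^+ 2 + complex.Im (f x) ^+ 2).
  by apply/funext => x /=; case: (f x).
apply: measurableT_comp; last by apply: measurable_funD; exact: measurable_funX.
by apply: continuous_measurable_fun; exact: sqrt_continuous.
Qed.

Lemma cone_diff_integrable K u : cone_diff K u -> mu.-integrable II (fun x => (u x)%:E).
Proof.
move=> hu; apply: measurable_bounded_integrable; first exact: measurable_I.
- rewrite [X in (X < _)%E](_ : _ = 1%:E); [exact: ltry | exact: mu_I].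
- exact: cone_diff_measurable hu.
- exists K; split; first exact: num_real.
  move=> M KM x; rewrite /= in_itv /= => hx; apply: le_trans (ltW KM).
  exact: cone_diff_bound hu hx.
Qed.

(** The variation is at most the sum of the values at 0 of the four cone parts, and the
integral at most the supremum of the modulus. *)
Lemma cone_diff_BVI K u v : cone_diff K u -> cone_diff K v ->
  BVI (fun x => u x +i* v x) /\ (BVnorm (fun x => u x +i* v x) <= (6 * K)%:E)%E.
Proof.
move=> hu hv; set f := fun x => _.
have K0 := cone_diff_K0 hu.
have hvar : (varI f <= (4 * K)%:E)%E.
  apply: (@le_trans _ _ (ctotal_variation 0 1 f)).
    by apply: ereal_inf_lbound; exists f => //; apply: aeW.
  apply: ge_ereal_sup => _ [s hs <-]; rewrite lee_fin.
  have [p [r [hp hr e]]] := hu; have [p' [r' [hp' hr' e']]] := hv.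
  have := coneD (coneD hp hr) (coneD hp' hr').
  have -> : K + K + (K + K) = 4 * K by ring.
  move=> hc; apply: (cvariation_le hc) hs => x y x0 xy y1.
  have x01 : 0 <= x <= 1 by rewrite x0 (le_trans xy).
  have y01 : 0 <= y <= 1 by rewrite y1 (le_trans x0).
  apply: le_trans (ler_normc_sum _ _) _; rewrite !e// !e'//.
  have [h1 _ _] := hp; have [h2 _ _] := hr; have [h3 _ _] := hp'; have [h4 _ _] := hr'.
  have := h1 _ _ x0 xy y1; have := h2 _ _ x0 xy y1.
  have := h3 _ _ x0 xy y1; have := h4 _ _ x0 xy y1 => k4 k3 k2 k1.
  rewrite (_ : p x + r x + (p' x + r' x) - (p y + r y + (p' y + r' y)) =
    ((p x - p y) + (r x - r y)) + ((p' x - p' y) + (r' x - r' y))); last by ring.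
  by apply: lerD; rewrite ler_norml; apply/andP; split; lra.
have hint : (\int[mu]_(x in II) (Normc.normc (f x))%:E <= (2 * K)%:E)%E.
  have mf : measurable_fun II (fun x => Normc.normc (f x)).
    by apply: normc_measurable; [exact: cone_diff_measurable hu|exact: cone_diff_measurable hv].
  apply: (@le_trans _ _ (\int[mu]_(x in II) (cst (2 * K)%:E x))%E).
    apply: ge0_le_integral => //.
    - by move=> x _; rewrite lee_fin normc_ge0.
    - exact/measurable_EFinP.
    - move=> x; rewrite /= in_itv /= => hx; rewrite lee_fin.
      apply: le_trans (ler_normc_sum _ _) _; rewrite mulrDl mul1r.
      by apply: lerD; [exact: cone_diff_bound hu hx|exact: cone_diff_bound hv hx].
  by rewrite integral_cst//= mu_I mule1.
split.
  split; first by split; [exact: cone_diff_integrable hu|exact: cone_diff_integrable hv].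
  by apply: le_lt_trans hvar _; rewrite ltry.
rewrite /BVnorm (_ : 6 * K = 4 * K + 2 * K); last by ring.
by rewrite EFinD; apply: leeD.
Qed.

(** Jordan decomposition with V(x) the variation of u on [x,1]: V and V - u are
nonincreasing, and adding M makes both nonnegative. *)
Lemma jordan_cone_diff T M u : (total_variation 0 1 u <= T%:E)%E ->
  (forall x, 0 <= x <= 1 -> `|u x| <= M) -> cone_diff (T + 2 * M) u.
Proof.
move=> hT hM.
have TVfin x y : 0 <= x -> x <= y -> y <= 1 -> total_variation x y u \is a fin_num.
  move=> x0 xy y1; rewrite ge0_fin_numE ?total_variation_ge0//.
  apply: le_lt_trans (ltry T); apply: le_trans hT.
  rewrite (@total_variationD _ 0 1 x)// ?(le_trans xy)// (@total_variationD _ x 1 y)//.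
  rewrite addeCA leeDl// adde_ge0// total_variation_ge0//.
pose V x := fine (total_variation x 1 u).
have VD x y : 0 <= x -> x <= y -> y <= 1 ->
    `|u y - u x| <= V x - V y.
  move=> x0 xy y1; rewrite -lee_fin EFinB /V !fineK; try by apply: TVfin => //; lra.
  rewrite (@total_variationD _ x 1 y)// addeK; last by apply: TVfin => //; lra.
  exact: total_variation_ge.
have V1 : V 1 = 0 by rewrite /V total_variationxx.
have V0 : V 0 <= T by rewrite -lee_fin fineK// TVfin.
have z01 : 0 <= (0 : R) <= 1 by rewrite lexx ler01.
have o01 : 0 <= (1 : R) <= 1 by rewrite lexx ler01.
have Ml x : 0 <= x <= 1 -> - M <= u x <= M by move=> hx; have := hM x hx; rewrite ler_norml.
exists (fun x => V x + M), (fun x => V x + M - u x); split.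
- have := Ml _ o01; have M0 : 0 <= M by apply: le_trans (hM _ o01).
  split; [|lra|lra].
  move=> x y x0 xy y1; have := VD x y x0 xy y1.
  have := normr_ge0 (u y - u x); lra.
- have := Ml _ z01; have := Ml _ o01 => k1 k2; split; [|lra|lra].
  move=> x y x0 xy y1; have := VD x y x0 xy y1; rewrite ler_norml; lra.
- by move=> x _; ring.
Qed.

End bv.

(** * Almost everywhere statements and the Jordan decomposition *)

Section ae.
Context {R : realType}.
Local Notation mu := (@lebesgue_measure R).

Section half_preimage.
Variable c : R.
Let phi (x : R) := x / 2 + c.

Let mphi : measurable_fun [set: R] phi.
Proof.
apply: measurable_funD => //; apply: measurable_funM => //.
Qed.

(** Half the image of Lebesgue measure under x |-> x/2 + c is Lebesgue measure, by
uniqueness, since it has the right values on intervals.  This makes the transfer operator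
well defined on classes of functions. *)
Lemma negligible_preimage_half N : mu.-negligible N -> mu.-negligible (phi @^-1` N).
Proof.
move=> [A [mA A0 NA]]; exists (phi @^-1` A); split.
- by rewrite -[X in measurable X]setTI; exact: mphi.
- pose nu0 : {measure set (measurableTypeR R) -> \bar R} :=
    @measure_function_pushforward__canonical__measure_function_Measure _ _
      (measurableTypeR R) (measurableTypeR R) R mu phi mphi.
  have h0 : 0 <= (2^-1 : R) by rewrite invr_ge0.
  pose nu : {measure set (measurableTypeR R) -> \bar R} := mscale (NngNum h0) nu0.
  have := @lebesgue_measure_unique R nu _ A mA; rewrite A0 => H.
  have : nu A = 0%E.
    rewrite -H// => X [[p q] _ <-].
    rewrite lebesgue_measure_itv /=.
    have -> : nu `]p, q]%classic = (2^-1%:E * mu (phi @^-1` `]p, q]%classic))%E by [].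
    have -> : phi @^-1` `]p, q]%classic = `]2 * (p - c), 2 * (q - c)]%classic.
      by apply/seteqP; split => x; rewrite /phi /= !in_itv /=; lra.
    rewrite lebesgue_measure_itv /= !lte_fin.
    have -> : (2 * (p - c) < 2 * (q - c)) = (p < q) by apply/idP/idP; lra.
    case: ifP => _; last by rewrite mule0.
    by rewrite -!EFinB -EFinM; congr (_%:E); lra.
  rewrite /nu /= /mscale /= => /eqP; rewrite mule_eq0 => /orP[|/eqP //].
  by rewrite eqe invr_eq0 pnatr_eq0.
- by move=> x /=; exact: NA.
Qed.

End half_preimage.

Definition ae01 (P : R -> Prop) := {ae mu, forall x, x \in `[0, 1]%R -> P x}.

Lemma in_I (x : R) : (x \in `[0, 1]%R) = (0 <= x <= 1).
Proof. by rewrite in_itv. Qed.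

Lemma ae01_all (P : R -> Prop) : (forall x, 0 <= x <= 1 -> P x) -> ae01 P.
Proof. by move=> h; apply: aeW => x; rewrite in_I; exact: h. Qed.

Lemma ae01_mono (P Q : R -> Prop) : (forall x, 0 <= x <= 1 -> P x -> Q x) -> ae01 P -> ae01 Q.
Proof.
move=> h; apply: negligibleS => x /=; apply: contra_not => hx x01.
by apply: h (hx x01); rewrite -in_I.
Qed.

Lemma ae01_mono2 (P Q S : R -> Prop) : (forall x, 0 <= x <= 1 -> P x -> Q x -> S x) ->
  ae01 P -> ae01 Q -> ae01 S.
Proof.
move=> h hP hQ; have := negligibleU hP hQ; apply: negligibleS => x /=.
apply: contra_notP => /not_orP[/contrapT k0 /contrapT k1] x01.
by apply: h (k0 x01) (k1 x01); rewrite -in_I.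
Qed.

Lemma ae01_and (P Q : R -> Prop) : ae01 P -> ae01 Q -> ae01 (fun x => P x /\ Q x).
Proof. by apply: ae01_mono2. Qed.

Lemma ae01_gt0 : ae01 (fun x => 0 < x).
Proof.
have : mu.-negligible [set (0 : R)].
  by apply/negligibleP; [exact: measurable_set1 | exact: lebesgue_measure_set1].
apply: negligibleS => x /=; apply: contra_notP => /eqP x1; rewrite in_I => /andP[? _].
by rewrite lt_neqAle eq_sym x1.
Qed.

Lemma ae01_forall (P : nat -> R -> Prop) : (forall n, ae01 (P n)) -> ae01 (fun x => forall n, P n x).
Proof.
move=> h; have := ae_foralln h; apply: negligibleS => x /=.
by apply: contra_not => hx x01 n; exact: hx.
Qed.

Lemma ae01_half (P : R -> Prop) : ae01 P -> ae01 (fun x => P (x / 2) /\ P ((1 + x) / 2)).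
Proof.
move=> h; have h0 := negligible_preimage_half 0 h.
have h1 := negligible_preimage_half (1 / 2) h.
have := negligibleU h0 h1; apply: negligibleS => x /=.
apply: contra_notP => /not_orP[/contrapT k0 /contrapT k1]; rewrite in_I => x01.
have [d0 d1] := branches_cc x01; split; first by have := k0; rewrite addr0; apply; rewrite in_I.
have -> : (1 + x) / 2 = x / 2 + 1 / 2 by lra.
by apply: k1; rewrite in_I; move: x01; lra.
Qed.

Lemma ae01_exists (P : R -> Prop) (p q : R) : ae01 P -> 0 <= p -> p < q -> q <= 1 ->
  exists x, p < x < q /\ P x.
Proof.
move=> h p0 pq q1; apply: contrapT => nh.
have : mu.-negligible `]p, q[%classic.
  apply: negligibleS h => x; rewrite /= in_itv /= => hx hP; apply: nh; exists x; split => //.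
  by apply: hP; rewrite in_I; lra.
move/negligibleP => /(_ (measurable_itv _)) m0.
have : lebesgue_measure (`]p, q[%classic : set R) = 0%E by exact: m0.
rewrite lebesgue_measure_itv /= lte_fin pq -EFinB => /eqP.
by rewrite eqe subr_eq0 => /eqP e; move: pq; rewrite e ltxx.
Qed.

Lemma ae01_lt1 : ae01 (fun x => x < 1).
Proof.
have : mu.-negligible [set (1 : R)].
  by apply/negligibleP; [exact: measurable_set1 | exact: lebesgue_measure_set1].
apply: negligibleS => x /=; apply: contra_notP => /eqP x1; rewrite in_I => /andP[_ ?].
by rewrite lt_neqAle x1.
Qed.

Lemma ae01_rtransfer a (u v : R -> R) : ae01 (fun x => u x = v x) ->
  ae01 (fun x => rtransfer a u x = rtransfer a v x).
Proof. by move=> /ae01_half; apply: ae01_mono => x _ [h1 h2]; rewrite /rtransfer h1 h2. Qed.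

(** A version of f whose variation is at most twice the norm, which exists if the norm is
not 0, has a Jordan decomposition.  Its supremum is controlled because its modulus cannot
exceed the mean of |f| by much everywhere on [0,1]. *)
Lemma BVI_cone_diff (f : R -> R[i]) : BVI f -> exists K u v, [/\ cone_diff K u, cone_diff K v,
  ae01 (fun x => f x = u x +i* v x) & (K%:E <= 10%:E * BVnorm f)%E].
Proof.
move=> [[iRe iIm] fv].
have mf : measurable_fun (`[(0 : R), (1 : R)]%classic : set R) (fun x => Normc.normc (f x)).
  apply: normc_measurable.
    by apply/measurable_EFinP; exact: measurable_int iRe.
  by apply/measurable_EFinP; exact: measurable_int iIm.
pose II := (`[(0 : R), (1 : R)]%classic : set R).
have v0 : (0 <= varI f)%E.
  apply: le_ereal_inf_tmp => _ [g _ <-].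
  apply: (@le_trans _ _ (cvariation 0 1 g [:: 1])%:E).
    by rewrite lee_fin sumr_ge0// => n _; exact: normc_ge0.
  by apply: ereal_sup_ubound; exists [:: 1] => //; apply: itv_partition1.
have i0 : (0 <= \int[mu]_(x in II) (Normc.normc (f x))%:E)%E.
  by apply: integral_ge0 => x _; rewrite lee_fin normc_ge0.
have mfE : measurable_fun II (fun x => (Normc.normc (f x))%:E : \bar R).
  exact/measurable_EFinP.
have ifin : (\int[mu]_(x in II) (Normc.normc (f x))%:E < +oo)%E.
  have h : mu.-integrable II (fun x => `|(complex.Re (f x))%:E| + `|(complex.Im (f x))%:E|)%E.
    have h3 := integrableD _ (integrable_abse iRe) (integrable_abse iIm).
    exact: h3 (measurable_itv _).
  have : mu.-integrable II (fun x => (Normc.normc (f x))%:E).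
    have h5 x : II x -> (`|(Normc.normc (f x))%:E| <=
        `| `|(complex.Re (f x))%:E| + `|(complex.Im (f x))%:E| |)%E.
      move=> _; rewrite /= lee_fin ger0_norm ?normc_ge0//; apply: le_trans (ler_norm _).
      by case: (f x) => p q; exact: ler_normc_sum.
    exact: (@le_integrable _ _ _ mu II (measurable_itv _)
      (fun x => (Normc.normc (f x))%:E) _ mfE h5 h).
  move=> /integrableP[_]; apply: le_lt_trans; rewrite le_eqVlt; apply/orP; left; apply/eqP.
  by apply: eq_integral => x _; rewrite gee0_abs// lee_fin normc_ge0.
have N0 : (0 <= BVnorm f)%E by exact: adde_ge0 v0 i0.
have Nfin : BVnorm f \is a fin_num.
  by rewrite ge0_fin_numE//; exact: lte_add_pinfty fv ifin.
pose N := fine (BVnorm f).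
have NE : BVnorm f = N%:E by rewrite /N fineK.
have Nge0 : 0 <= N by rewrite -lee_fin -NE.
(* If the norm vanishes, no version need attain the infimum, but f is 0 almost everywhere. *)
have [Nz|Nnz] := eqVneq N 0.
  have iz : (\int[mu]_(x in II) (Normc.normc (f x))%:E = 0)%E.
    apply/eqP; rewrite eq_le i0 andbT; apply: (@le_trans _ _ (BVnorm f)).
      exact: leeDr.
    by rewrite NE Nz.
  exists 0, (fun=> 0), (fun=> 0); split; [exact: cone_diff0|exact: cone_diff0| |].
  - have : ae_eq mu II (fun x => (Normc.normc (f x))%:E) (cst 0%E).
      apply/(ae_eq_integral_abs mu _ mfE); first exact: measurable_itv.
      by rewrite -[RHS]iz; apply: eq_integral => x _; rewrite gee0_abs// lee_fin normc_ge0.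
    apply: negligibleS => x /=; apply: contra_not => hx x01.
    by have [] : (Normc.normc (f x))%:E = 0%:E by [apply: hx]; exact: Normc.eq0_normc.
  - by rewrite NE Nz mule0.
have Npos : 0 < N by rewrite lt_neqAle eq_sym Nnz.
have vfin : varI f \is a fin_num by rewrite ge0_fin_numE.
have [_ [g fg <-] hg] := lb_ereal_inf_adherent Npos vfin.
have {}hg : (ctotal_variation 0 1 g <= (2 * N)%:E)%E.
  apply: (le_trans (ltW hg)); rewrite mulrDl mul1r EFinD leeD2r// -NE.
  by rewrite /BVnorm leeDl.
have [x0 [x001 gx0]] : exists x, 0 <= x <= 1 /\ Normc.normc (g x) <= 2 * N.
  apply: contrapT => nh.
  have : ((2 * N)%:E <= N%:E)%E.
    rewrite -[leRHS]NE; apply: (@le_trans _ _ (\int[mu]_(x in II) (Normc.normc (f x))%:E)%E); last first.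
      by rewrite /BVnorm leeDr.
    apply: (@le_trans _ _ (\int[mu]_(x in II) (cst (2 * N)%:E x))%E).
      have muI : mu II = 1%:E by exact: mu_I.
      rewrite integral_cst; last exact: measurable_itv.
      by rewrite [X in (_ <= _ * X)%E](_ : _ = 1%:E) ?mule1 //; exact: mu_I.
    apply: ae_ge0_le_integral.
    - exact: measurable_itv.
    - by move=> x _; rewrite /= lee_fin mulr_ge0.
    - exact: measurable_cst.
    - by move=> x _; rewrite /= lee_fin normc_ge0.
    - exact: mfE.
    - apply: negligibleS fg => x /=; apply: contra_not => hx x01.
      rewrite /= lee_fin leNgt; apply/negP => hlt; apply: nh; exists x.
      by split; [rewrite -in_I | rewrite -hx// ltW].
  by rewrite lee_fin; lra.
(* Common to the real and the imaginary part of the version g. *)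
have key (w : R -> R) : (forall x y, `|w y - w x| <= Normc.normc (g y - g x)) ->
    `|w x0| <= 2 * N -> cone_diff (10 * N) w.
  move=> hw hw0.
  have TVw : (total_variation 0 1 w <= (2 * N)%:E)%E.
    apply: le_trans hg; apply: ge_ereal_sup => _ [_ [s hs <-] <-].
    apply: (@le_trans _ _ (cvariation 0 1 g s)%:E); last first.
      by apply: ereal_sup_ubound; exists s.
    by rewrite lee_fin; apply: ler_sum => n _; apply: hw.
  rewrite (_ : 10 * N = 2 * N + 2 * (4 * N)); last by ring.
  apply: jordan_cone_diff => // x x01.
  have mono (p q : R) : 0 <= p -> p <= q -> q <= 1 -> `|w q - w p| <= 2 * N.
    move=> p0 pq q1; rewrite -lee_fin; apply: le_trans TVw.
    apply: (le_trans (total_variation_ge _ pq)).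
    rewrite (@total_variationD _ 0 1 p)// ?(le_trans pq)// (@total_variationD _ p 1 q)//.
    by rewrite addeCA leeDl// adde_ge0// total_variation_ge0.
  have : `|w x - w x0| <= 2 * N.
    have [xx|/ltW xx] := leP x x0; [rewrite distrC|]; apply: mono => //; lra.
  by have := ler_normD (w x - w x0) (w x0); rewrite subrK; lra.
exists (10 * N), (fun x => complex.Re (g x)), (fun x => complex.Im (g x)); split.
- apply: key; last exact: le_trans (ler_Re_normc _) gx0.
  by move=> x y; have := ler_Re_normc (g y - g x); case: (g x); case: (g y).
- apply: key; last exact: le_trans (ler_Im_normc _) gx0.
  by move=> x y; have := ler_Im_normc (g y - g x); case: (g x); case: (g y).
- by apply: ae01_mono fg => x _ ->; case: (g x).
- by rewrite NE -EFinM.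
Qed.

End ae.

(** * Simplicity for real functions *)

Section essential_limit.
Context {R : realType}.
Implicit Types (u v p : R -> R) (b K x y k : R).

(** The essential right limit at 1/2.  Unlike the value at 1/2, it depends on the class
of u only, so it may be applied to an eigenvalue equation that holds almost everywhere. *)
Definition ess_rlim u b := forall e, 0 < e -> exists2 eta : R, 0 < eta &
  ae01 (fun x => 1 / 2 < x < 1 / 2 + eta -> `|u x - b| <= e).

Lemma ess_rlim_unique u v b b' : ae01 (fun x => u x = v x) -> ess_rlim u b -> ess_rlim v b' -> b = b'.
Proof.
move=> uv hu hv; apply/eqP; rewrite -subr_eq0 -normr_le0; apply/ler_addgt0Pr => e e0.
have [eta eta0 h] := hu (e / 2) (divr_gt0 e0 (ltr0n _ 2)).
have [eta' eta'0 h'] := hv (e / 2) (divr_gt0 e0 (ltr0n _ 2)).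
have hall := ae01_and uv (ae01_and h h').
pose m := Num.min (1 / 2) (Num.min eta eta').
have m0 : 0 < m by rewrite !lt_min eta0 eta'0 !andbT; lra.
have m1 : m <= 1 / 2 by rewrite ge_min lexx.
have m2 : m <= eta by rewrite !ge_min lexx orbT.
have m3 : m <= eta' by rewrite !ge_min lexx !orbT.
have [||| x [/andP[x1 x2] [e1 [e2 e3]]]] := ae01_exists (p := 1 / 2) (q := 1 / 2 + m) hall; try lra.
have {}e2 : `|u x - b| <= e / 2 by apply: e2; lra.
have {}e3 : `|v x - b'| <= e / 2 by apply: e3; lra.
rewrite add0r; have -> : b - b' = (v x - b') - (u x - b) by rewrite e1; ring.
by apply: le_trans (ler_normB _ _) _; lra.
Qed.

Lemma ess_rlimD u v b b' : ess_rlim u b -> ess_rlim v b' -> ess_rlim (fun x => u x + v x) (b + b').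
Proof.
move=> hu hv e e0.
have [eta eta0 h] := hu (e / 2) (divr_gt0 e0 (ltr0n _ 2)).
have [eta' eta'0 h'] := hv (e / 2) (divr_gt0 e0 (ltr0n _ 2)).
exists (Num.min eta eta'); first by rewrite lt_min eta0.
apply: (ae01_mono2 _ h h') => x _ hx hx' /andP[x1 x2].
have m2 : Num.min eta eta' <= eta by rewrite ge_min lexx.
have m3 : Num.min eta eta' <= eta' by rewrite ge_min lexx orbT.
have e2 : `|u x - b| <= e / 2 by apply: hx; lra.
have e3 : `|v x - b'| <= e / 2 by apply: hx'; lra.
rewrite opprD addrACA; apply: le_trans (ler_normD _ _) _; lra.
Qed.

Lemma ess_rlimZ k u b : ess_rlim u b -> ess_rlim (fun x => k * u x) (k * b).
Proof.
move=> hu e e0; have k1 : 0 < `|k| + 1 by have := normr_ge0 k; lra.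
have [eta eta0 h] := hu _ (divr_gt0 e0 k1).
exists eta => //; apply: ae01_mono h => x _ hx /hx {}hx.
rewrite -mulrBr normrM; apply: (@le_trans _ _ ((`|k| + 1) * `|u x - b|)).
  by apply: ler_wpM2r => //; lra.
by rewrite mulrC -ler_pdivlMr.
Qed.

Lemma ess_rlim_step c : 0 < c -> ess_rlim (step c) (1 / 2 < c)%R%:R.
Proof.
move=> c0 e e0; have [ch|ch] := ltP (1 / 2) c.
  exists (c - 1 / 2); first by lra.
  apply: ae01_all => x _ hx; rewrite /step (_ : x < c = true); last by lra.
  by rewrite subrr normr0 ltW.
exists 1 => //; apply: ae01_all => x _ hx; rewrite /step (_ : x < c = false); last by apply/negP; lra.
by rewrite subrr normr0 ltW.
Qed.

(** The cone on (0,1], with the bound K imposed there only: the step of open_cone_reduce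
may increase the value at 0, by the jump of p at 1/2. *)
Definition open_cone K p := forall x y, 0 < x -> x <= y -> y <= 1 ->
  [/\ 0 <= p y, p y <= p x & p x <= K].

Lemma cone_open_cone K p : cone K p -> open_cone K p.
Proof.
move=> hp x y x0 xy y1; have [h _ _] := hp.
have x01 : 0 <= x <= 1 by lra.
have y01 : 0 <= y <= 1 by lra.
have /andP[_ ?] := cone_itv hp x01; have /andP[? _] := cone_itv hp y01.
by split => //; apply: h => //; exact: ltW.
Qed.

(** The right limit is the supremum over (1/2,1]; its position between the values on both
sides of 1/2 is what the next reduction uses. *)
Lemma open_cone_ess_rlim K p : open_cone K p -> exists b, [/\ ess_rlim p b,
  (forall x, 0 < x <= 1 / 2 -> b <= p x) & (forall x, 1 / 2 < x <= 1 -> p x <= b)].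
Proof.
move=> hp; pose E := [set p y | y in [set y | 1 / 2 < y <= 1]].
have hE : has_sup E.
  split; first by exists (p 1), 1 => //=; lra.
  exists K => _ [y /= hy <-]; have [|||_ _] := hp y 1; try lra; exact.
have hi x : 1 / 2 < x <= 1 -> p x <= sup E.
  by move=> hx; apply: ub_le_sup; [case: hE|exists x].
exists (sup E); split => //.
- move=> e e0; have [_ [y /= hy <-] ey] := sup_adherent e0 hE.
  exists (y - 1 / 2); first by lra.
  apply: ae01_all => x x01 hx; have x1 : 1 / 2 < x <= 1 by lra.
  have := hi x x1; have [|||_ h1 _] := hp x y; try lra.
  by rewrite ler_norml => ?; apply/andP; split; lra.
- move=> x hx; apply: ge_sup; first by case: hE.
  by move=> _ [y /= hy <-]; have [|||_ h1 _] := hp x y; try lra; exact.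
Qed.

End essential_limit.

Section simple_real.
Context {R : realType} (a lam : R).
Hypothesis ha : 1 / 2 < a < 1.
Hypothesis hlam : growth_rate a lam.
Implicit Types (u v p r w : R -> R) (b K x y : R).

Let q := lam^-1.
Let q01 : 0 <= q < 1. Proof. exact: q_itv hlam. Qed.
Let q0 : 0 <= q. Proof. by case/andP: q01. Qed.
Let lam0 : 0 < lam. Proof. exact: lam_gt0 hlam. Qed.
Let lamq : lam * q = 1. Proof. by rewrite /q mulfV// gt_eqF. Qed.
Let c_ k := end_orbit a 1 k.
Let f := eigf a lam.

(** The first branch takes values at least b and the second one values at most b, so
subtracting b keeps the sum nonnegative and bounded by the first branch alone. *)
Lemma open_cone_reduce K p b : open_cone K p ->
  (forall x, 0 < x <= 1 / 2 -> b <= p x) -> (forall x, 1 / 2 < x <= 1 -> p x <= b) ->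
  open_cone K (fun x => rtransfer a p x - b).
Proof.
move=> hp hlo hhi x y x0 xy y1; have x00 := ltW x0; have y00 := le_trans x00 xy.
rewrite !rtransferE//.
have p2 z : 0 < z -> z <= 1 -> 0 <= p ((1 + z) / 2).
  by move=> z0 z1; have [|||h _ _] := hp ((1 + z) / 2) 1; have [|||k0 k1 _] := hp ((1 + z) / 2) ((1 + z) / 2); try lra.
split.
- have h1 : b <= p (y / 2) by apply: hlo; lra.
  have h2 : 0 <= p ((1 + y) / 2) by apply: p2; lra.
  have : 0 <= ((1 + y) / 2 < a)%R%:R * p ((1 + y) / 2) by apply: mulr_ge0.
  lra.
- apply: lerD => //; apply: lerD; first by have [|||_ h _] := hp (x / 2) (y / 2); try lra; exact.
  have [ya|ya] := ltP ((1 + y) / 2) a.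
    rewrite (_ : (1 + x) / 2 < a = true); last by lra.
    by rewrite !mul1r; have [|||_ h _] := hp ((1 + x) / 2) ((1 + y) / 2); try lra; exact.
  by rewrite mul0r mulr_ge0// p2//; lra.
- have [|||_ _ h1] := hp (x / 2) (x / 2); try lra.
  have h2 : p ((1 + x) / 2) <= b by apply: hhi; lra.
  have h3 : 0 <= p ((1 + x) / 2) by apply: p2; lra.
  have h4 : ((1 + x) / 2 < a)%R%:R * p ((1 + x) / 2) <= p ((1 + x) / 2).
    by case: (_ < a); rewrite ?mul1r ?mul0r.
  lra.
Qed.

Definition eigf_partial n x := \sum_(0 <= k < n) q ^+ k * step (c_ k) x.

Lemma ess_rlim_eigf_partial n : ess_rlim (eigf_partial n) (\sum_(0 <= k < n) q ^+ k * digit a 1 k).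
Proof.
elim: n => [|n IH].
  move=> e e0; exists 1 => //; apply: ae01_all => x _ _.
  by rewrite /eigf_partial !big_geq// subrr normr0 ltW.
rewrite big_nat_recr//=.
have -> : eigf_partial n.+1 = fun x => eigf_partial n x + q ^+ n * step (c_ n) x.
  by apply/funext => x; rewrite /eigf_partial big_nat_recr.
apply: ess_rlimD => //; apply: ess_rlimZ; apply: ess_rlim_step.
by have /andP[] := end_orbit1_itv ha n.
Qed.

Lemma rtransfer_eigf_partial n x : 0 <= x < 1 ->
  rtransfer a (eigf_partial n) x = \sum_(0 <= k < n) q ^+ k * digit a 1 k +
    \sum_(0 <= k < n) q ^+ k * step (c_ k.+1) x.
Proof.
move=> x01; elim: n => [|n IH].
  by rewrite /rtransfer /eigf_partial !big_geq// mulr0 !addr0.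
have -> : eigf_partial n.+1 = fun x => eigf_partial n x + q ^+ n * step (c_ n) x.
  by apply/funext => y; rewrite /eigf_partial big_nat_recr.
rewrite rtransferD rtransferZ IH rtransfer_step ?end_orbit1_itv// !big_nat_recr//=.
rewrite (_ : digit a (c_ n) 0 = digit a 1 n)// (_ : step (next_end a (c_ n)) = step (c_ n.+1))//.
ring.
Qed.

(** Apply lam^-1 L_a to the expansion of u and reduce both cone functions by their right
limits.  The constants that appear add up to b/lam, by taking essential right limits in
the expansion itself, and this is the new term for c_0 = 1. *)
Lemma eigen_expansion K u b p0 r0 : ae01 (fun x => rtransfer a u x = lam * u x) ->
  ess_rlim u b -> open_cone K p0 -> open_cone K r0 -> ae01 (fun x => u x = p0 x - r0 x) ->
  forall n, exists p r, [/\ open_cone K p, open_cone K r &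
    ae01 (fun x => u x = q ^+ n * (p x - r x) + b * q * eigf_partial n x)].
Proof.
move=> hu hb hp0 hr0 hu0; elim=> [|n [p [r [hp hr hn]]]].
  exists p0, r0; split => //; apply: ae01_mono hu0 => x _ ->.
  by rewrite expr0 mul1r /eigf_partial big_geq// mulr0 addr0.
have [bp [lp lop hip]] := open_cone_ess_rlim hp; have [br [lr lor hir]] := open_cone_ess_rlim hr.
exists (fun x => rtransfer a p x - bp), (fun x => rtransfer a r x - br).
split; [exact: open_cone_reduce|exact: open_cone_reduce|].
set s := \sum_(0 <= k < n) q ^+ k * digit a 1 k.
(* Essential right limits on both sides of the expansion. *)
have eb : b = q ^+ n * (bp + -1 * br) + b * q * s.
  have hh := ess_rlimD (ess_rlimZ (q ^+ n) (ess_rlimD lp (ess_rlimZ (-1) lr))) (ess_rlimZ (b * q) (ess_rlim_eigf_partial n)).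
  apply: (ess_rlim_unique _ hb hh); apply: ae01_mono hn => x _ ->; ring.
have hL := ae01_and hu (ae01_and (ae01_rtransfer a hn) ae01_lt1).
apply: ae01_mono hL => x /andP[x0 x1] [h1 [h2 xl1]].
have x01 : 0 <= x < 1 by rewrite x0.
have -> : u x = q * rtransfer a u x by rewrite h1 mulrA (mulrC q) lamq mul1r.
have e2 : rtransfer a (fun y => q ^+ n * (p y - r y) + b * q * eigf_partial n y) x =
    q ^+ n * (rtransfer a p x - rtransfer a r x) + b * q * rtransfer a (eigf_partial n) x by rewrite /rtransfer; ring.
rewrite h2 e2 rtransfer_eigf_partial// -/s.
have -> : eigf_partial n.+1 x = 1 + q * \sum_(0 <= k < n) q ^+ k * step (c_ k.+1) x.
  rewrite /eigf_partial big_nat_recl// expr0 mul1r {1}/step (_ : x < c_ 0 = true)//.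
  by rewrite mulr_sumr; congr (1 + _); apply: eq_bigr => k _; rewrite exprS mulrA.
move: (\sum_(0 <= k < n) q ^+ k * step _ _) => t.
rewrite (exprS q n).
rewrite [in RHS](_ : b * q * (1 + q * t) = q * (q ^+ n * (bp + -1 * br) + b * q * s) + b * q * q * t).
  ring.
by rewrite -eb; ring.
Qed.

(** The cone part of the expansion tends to 0 as n grows. *)
Lemma eigen_line K u w : ae01 (fun x => rtransfer a u x = lam * u x) -> cone_diff K w ->
  ae01 (fun x => u x = w x) -> exists k, ae01 (fun x => u x = k * f x).
Proof.
move=> hu [p0 [r0 [hp0 hr0 e0]]] huw.
have op := cone_open_cone hp0; have or := cone_open_cone hr0.
have hu0 : ae01 (fun x => u x = p0 x - r0 x) by apply: ae01_mono huw => x x01 ->; rewrite e0.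
have [bp [lp _ _]] := open_cone_ess_rlim op; have [br [lr _ _]] := open_cone_ess_rlim or.
have hb : ess_rlim u (bp + -1 * br).
  have hh := ess_rlimD lp (ess_rlimZ (-1) lr).
  move=> e ee; have [eta eta0 h] := hh e ee; exists eta => //.
  by apply: (ae01_mono2 _ hu0 h) => x _ -> h2 /h2; rewrite (mulN1r (r0 x)).
set b := bp + _ in hb.
have H := eigen_expansion hu hb op or hu0.
exists (b * q).
have H' : ae01 (fun x => forall n, `|u x - b * q * eigf_partial n x| <= K * q ^+ n).
  apply: ae01_forall => n; have [p [r [hp hr hn]]] := H n.
  apply: (ae01_mono2 _ hn ae01_gt0) => x /andP[_ x1] -> x0.
  rewrite addrK normrM ger0_norm ?exprn_ge0// mulrC ler_wpM2r ?exprn_ge0//.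
  have [||k1 _ k2] := hp x x x0; [exact: lexx|exact: x1|].
  have [||k3 _ k4] := hr x x x0; [exact: lexx|exact: x1|].
  by rewrite ler_norml; apply/andP; split; lra.
apply: ae01_mono H' => x _ hx.
have hs : eigf_partial n x @[n --> \oo] --> f x := eigf_has_sum hlam x.
have hc : (fun n => `|u x - b * q * eigf_partial n x|) @ \oo --> `|u x - b * q * f x|.
  apply: cvg_norm; apply: cvgB; first exact: cvg_cst.
  by apply: cvgM; [exact: cvg_cst | exact: hs].
have h0 : (fun n => K * q ^+ n) @ \oo --> K * 0.
  apply: cvgM; first exact: cvg_cst.
  by apply: cvg_expr; rewrite ger0_norm//; case/andP: q01.
have : `|u x - b * q * f x| <= K * 0.
  by apply: (ler_cvg_to hc h0); apply: nearW.
by rewrite mulr0 normr_le0 subr_eq0 => /eqP.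
Qed.

(** By induction L_a^n u = lam^n u + n lam^(n-1) k f, whereas the iterates of a function
of bounded variation are O(lam^n). *)
Lemma no_jordan K u w (k : R) : ae01 (fun x => rtransfer a u x = lam * u x + k * f x) -> cone_diff K w ->
  ae01 (fun x => u x = w x) -> k = 0.
Proof.
move=> hu hw huw.
have hit n : ae01 (fun x => iter n (rtransfer a) w x = lam ^+ n * u x + n%:R * lam ^+ n * q * k * f x).
  elim: n => [|n IH].
    by apply: ae01_mono huw => x _ ->; rewrite /= expr0 !mul0r addr0 mul1r.
  have h := ae01_and hu (ae01_and (ae01_rtransfer a IH) ae01_lt1).
  apply: ae01_mono h => x /andP[x0 _] [h1 [h2 x1]]; rewrite iterS h2.
  have -> : rtransfer a (fun y => lam ^+ n * u y + n%:R * lam ^+ n * q * k * f y) x =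
     lam ^+ n * rtransfer a u x + n%:R * lam ^+ n * q * k * rtransfer a f x by rewrite /rtransfer; ring.
  rewrite h1 (rtransfer_eigf ha hlam) ?x0// exprS -natr1.
  have -> : lam ^+ n * (lam * u x + k * f x) = lam ^+ n * lam * u x + (lam * q) * lam ^+ n * k * f x.
    by rewrite lamq; ring.
  rewrite -/f; ring.
have [x [/andP[x0 x1] [hx ux]]] := ae01_exists (ae01_and (ae01_forall hit) huw) (lexx 0) ltr01 (lexx 1).
have fx : 1 <= f x by apply: eigf_ge1.
have B n : n%:R * `|k| <= (K * eigf_max lam + `|u x|) * lam.
  have x01 : 0 <= x <= 1 by rewrite !ltW.
  have := cone_diff_bound (cone_diff_iter_rtransfer ha hlam n hw) x01; rewrite hx.
  have ln : 0 < lam ^+ n by rewrite exprn_gt0.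
  set t := n%:R * lam ^+ n * q * k * f x => h1.
  have h2 : `|t| <= K * (eigf_max lam * lam ^+ n) + lam ^+ n * `|u x|.
    have -> : t = (lam ^+ n * u x + t) - lam ^+ n * u x by ring.
    apply: le_trans (ler_normB _ _) _; apply: lerD => //.
    by rewrite normrM gtr0_norm.
  have h3 : n%:R * `|k| * (lam ^+ n * q) <= `|t|.
    have -> : `|t| = n%:R * `|k| * (lam ^+ n * q) * f x.
      rewrite /t !normrM normr_nat (gtr0_norm ln) (ger0_norm q0) (ger0_norm (le_trans ler01 fx)); ring.
    by rewrite ler_peMr// !mulr_ge0// ltW.
  rewrite -(ler_pM2r ln).
  have -> : n%:R * `|k| * lam ^+ n = n%:R * `|k| * (lam ^+ n * q) * lam.
    by rewrite -!mulrA (mulrC q) lamq mulr1.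
  have -> : (K * eigf_max lam + `|u x|) * lam * lam ^+ n = (K * (eigf_max lam * lam ^+ n) + lam ^+ n * `|u x|) * lam by ring.
  by rewrite ler_pM2r//; apply: le_trans h2.
apply/eqP; rewrite -normr_le0 leNgt; apply/negP => k0.
have := B (Num.truncn ((K * eigf_max lam + `|u x|) * lam / `|k|)).+1.
by rewrite leNgt -ltr_pdivrMr// truncnS_gt.
Qed.

End simple_real.

(** * The spectrum on complex functions *)

Section complex_transfer.
Context {R : realType} (a : R).
Implicit Types (f g : R -> R[i]) (z : R[i]) (x : R).

Lemma ReM z z' : complex.Re (z * z') = complex.Re z * complex.Re z' - complex.Im z * complex.Im z'.
Proof. by case: z; case: z'. Qed.

Lemma ImM z z' : complex.Im (z * z') = complex.Re z * complex.Im z' + complex.Im z * complex.Re z'.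
Proof. by case: z; case: z'. Qed.

Lemma ReD z z' : complex.Re (z + z') = complex.Re z + complex.Re z'.
Proof. by case: z; case: z'. Qed.

Lemma ImD z z' : complex.Im (z + z') = complex.Im z + complex.Im z'.
Proof. by case: z; case: z'. Qed.

Lemma ReN z : complex.Re (- z) = - complex.Re z. Proof. by case: z. Qed.

Lemma ImN z : complex.Im (- z) = - complex.Im z. Proof. by case: z. Qed.

Lemma Re_transfer f x : complex.Re (transfer a f x) = rtransfer a (fun y => complex.Re (f y)) x.
Proof. by rewrite /transfer ReD ReM /= mul0r subr0. Qed.

Lemma Im_transfer f x : complex.Im (transfer a f x) = rtransfer a (fun y => complex.Im (f y)) x.
Proof. by rewrite /transfer ImD ImM /= mul0r addr0. Qed.

Lemma Re_iter_transfer n f x :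
  complex.Re (iter n (transfer a) f x) = iter n (rtransfer a) (fun y => complex.Re (f y)) x.
Proof.
elim: n x => //= n IH x; rewrite Re_transfer; congr (rtransfer a _ x).
by apply/funext => y; exact: IH.
Qed.

Lemma Im_iter_transfer n f x :
  complex.Im (iter n (transfer a) f x) = iter n (rtransfer a) (fun y => complex.Im (f y)) x.
Proof.
elim: n x => //= n IH x; rewrite Im_transfer; congr (rtransfer a _ x).
by apply/funext => y; exact: IH.
Qed.

Lemma complexE z : z = complex.Re z +i* complex.Im z.
Proof. by case: z. Qed.

Lemma transfer_ae f g : aeI f g -> aeI (transfer a f) (transfer a g).
Proof.
by move=> /ae01_half; apply: ae01_mono => x _ [h1 h2]; rewrite /transfer h1 h2.
Qed.

Lemma transferZ z f x : transfer a (fun y => z * f y) x = z * transfer a f x.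
Proof. by rewrite /transfer mulrDr; congr (_ + _); rewrite mulrCA. Qed.

Lemma iter_transfer_eigen z f n : aeI (op_minus (transfer a) z f) (cst 0) ->
  aeI (iter n (transfer a) f) (fun x => z ^+ n * f x).
Proof.
move=> hf; elim: n => [|n IH]; first by apply: ae01_all => x _; rewrite /= expr0 mul1r.
apply: (ae01_mono2 _ hf (transfer_ae IH)) => x _ h1; rewrite iterS => ->.
rewrite transferZ exprSr -mulrA; congr (_ * _).
by move: h1; rewrite /op_minus /= => /eqP; rewrite subr_eq0 => /eqP.
Qed.

Lemma iter_rtransfer_ae (u v : R -> R) n : ae01 (fun x => u x = v x) ->
  ae01 (fun x => iter n (rtransfer a) u x = iter n (rtransfer a) v x).
Proof. by move=> uv; elim: n => //= n IH; exact: ae01_rtransfer. Qed.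

End complex_transfer.

Section spectral.
Context {R : realType} (a lam : R).
Hypothesis ha : 1 / 2 < a < 1.
Hypothesis hlam : growth_rate a lam.
Implicit Types (f g : R -> R[i]) (z : R[i]) (x : R).

Let lam0 : 0 < lam. Proof. exact: lam_gt0 hlam. Qed.
Let e_ := eigf a lam.
Let eigc : R -> R[i] := fun x => e_ x +i* 0.

Lemma cone_eigf : cone (eigf_max lam) e_.
Proof.
split.
- by move=> x y x0 xy y1; apply: eigf_le.
- exact: eigf_ge0.
- by rewrite /e_ eigf0.
Qed.

Lemma eigc_BVI : BVI eigc.
Proof.
have C0 := ltW (eigf_max_gt0 hlam).
have h0 : cone_diff (eigf_max lam) (fun=> 0 : R).
  exists (fun=> 0), (fun=> 0); split; [by split|by split|by move=> *; rewrite subr0].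
by have [] := cone_diff_BVI (cone_cone_diff cone_eigf) h0.
Qed.

Lemma eigc_neq0 : ~ aeI eigc (cst 0).
Proof.
move=> h; have [x [/andP[x0 x1] []]] := ae01_exists h (lexx 0) ltr01 (lexx 1).
by have := eigf_ge1 hlam x1; rewrite -/e_ => /[swap] ->; rewrite ler10.
Qed.

Lemma eigc_eigen : aeI (op_minus (transfer a) lam%:C eigc) (cst 0).
Proof.
apply: ae01_mono ae01_lt1 => x /andP[x0 _] x1.
rewrite /op_minus /=; apply/eqP; rewrite subr_eq0; apply/eqP.
rewrite [LHS]complexE [RHS]complexE Re_transfer Im_transfer ReM ImM /=.
rewrite -/e_ (rtransfer_eigf ha hlam) ?x0// !mul0r subr0 addr0 mulr0; congr (_ +i* _).
by rewrite /rtransfer mulr0 addr0.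
Qed.

(** Pointwise |z|^n |f| = |L_a^n f| = O(lam^n) almost everywhere. *)
Lemma transfer_injective z f : lam < Normc.normc z -> BVI f ->
  aeI (op_minus (transfer a) z f) (cst 0) -> aeI f (cst 0).
Proof.
move=> hz /BVI_cone_diff[K [u [v [hu hv fe _]]]] hf.
have z0 : 0 < Normc.normc z by apply: lt_trans hz.
have huae : ae01 (fun x => complex.Re (f x) = u x) by apply: ae01_mono fe => x _ ->.
have hvae : ae01 (fun x => complex.Im (f x) = v x) by apply: ae01_mono fe => x _ ->.
have h n := ae01_and (iter_transfer_eigen n hf) (ae01_and (iter_rtransfer_ae a n huae) (iter_rtransfer_ae a n hvae)).
apply: ae01_mono (ae01_forall h) => x x01 hx.
apply: Normc.eq0_normc; apply/eqP; rewrite eq_le normc_ge0 andbT.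
pose r := lam / Normc.normc z.
have r01 : 0 <= r < 1 by rewrite divr_ge0 ?ltW//= ltr_pdivrMr// mul1r.
apply: (le_of_geo (B := 2 * K * eigf_max lam) r01) => n; rewrite add0r.
have [e1 [e2 e3]] := hx n.
have zn0 : 0 < Normc.normc z ^+ n by rewrite exprn_gt0.
rewrite /r expr_div_n mulrA ler_pdivlMr// mulrC.
have -> : Normc.normc z ^+ n * Normc.normc (f x) = Normc.normc (iter n (transfer a) f x).
  rewrite e1 Normc.normcM; congr (_ * _); elim: n {h e1 e2 e3 zn0 hx} => [|n IH].
    by rewrite !expr0 Normc.normc1.
  by rewrite !exprS Normc.normcM IH.
rewrite [X in Normc.normc X]complexE Re_iter_transfer Im_iter_transfer e2 e3.
apply: le_trans (ler_normc_sum _ _) _.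
have -> : 2 * K * eigf_max lam * lam ^+ n = K * (eigf_max lam * lam ^+ n) + K * (eigf_max lam * lam ^+ n) by ring.
by apply: lerD; [exact: cone_diff_bound (cone_diff_iter_rtransfer ha hlam n hu) x01|exact: cone_diff_bound (cone_diff_iter_rtransfer ha hlam n hv) x01].
Qed.

(** The solution of (L_a - z) f = g is - sum_n z^-(n+1) L_a^n g, split into real and
imaginary parts. *)
Lemma neumann_solve z K (u v : R -> R) : lam < Normc.normc z -> cone_diff K u -> cone_diff K v ->
  exists X Y, [/\ cone_diff (4 * ((Normc.normc z)^-1 * eigf_max lam / (1 - (Normc.normc z)^-1 * lam)) * K) X,
    cone_diff (4 * ((Normc.normc z)^-1 * eigf_max lam / (1 - (Normc.normc z)^-1 * lam)) * K) Y &
    forall x, 0 <= x <= 1 ->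
    op_minus (transfer a) z (fun x => X x +i* Y x) x = u x +i* v x].
Proof.
move=> hz hu hv.
have z0 : 0 < Normc.normc z by apply: lt_trans hz.
have zn0 : z != 0 by apply: contraTneq z0 => ->; rewrite Normc.normc0 ltxx.
set rho := (Normc.normc z)^-1.
have rho0 : 0 <= rho by rewrite invr_ge0 ltW.
have rho1 : rho * lam < 1 by rewrite mulrC ltr_pdivrMr// mul1r.
pose s n := complex.Re (z^-1 ^+ n.+1); pose t n := complex.Im (z^-1 ^+ n.+1).
have normw n : Normc.normc (z^-1 ^+ n.+1) = rho * rho ^+ n.
  elim: n => [|n IH]; first by rewrite expr1 Normc.normcV expr0 mulr1.
  by rewrite exprS Normc.normcM IH Normc.normcV -exprS.
have hs n : `|s n| <= rho * rho ^+ n by rewrite -normw; exact: ler_Re_normc.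
have ht n : `|t n| <= rho * rho ^+ n by rewrite -normw; exact: ler_Im_normc.
have hs' n : `|s n.+1| <= rho * rho * rho ^+ n by rewrite -mulrA -exprS; exact: hs.
have ht' n : `|t n.+1| <= rho * rho * rho ^+ n by rewrite -mulrA -exprS; exact: ht.
pose zr := complex.Re z; pose zi := complex.Im z.
have zw n : z * z^-1 ^+ n.+2 = z^-1 ^+ n.+1 by rewrite exprS mulrA mulfV// mul1r.
have sE : s = fun n => zr * s n.+1 + (- zi) * t n.+1.
  by apply/funext => n; rewrite /s -zw ReM mulNr.
have tE : t = fun n => zr * t n.+1 + zi * s n.+1.
  by apply/funext => n; rewrite /t -zw ImM.
have z10 : zr * s 0%N - zi * t 0%N = 1 by rewrite /s /t -ReM expr1 mulfV.
have z01 : zr * t 0%N + zi * s 0%N = 0 by rewrite /s /t -ImM expr1 mulfV.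
pose S := neumann a s; pose T := neumann a t.
(* The real and imaginary parts of z^-(n+2) z = z^-(n+1), summed against the iterates of
   w: L S = Re (z (S + i T)) - w and L T = Im (z (S + i T)). *)
have key w x : cone_diff K w -> 0 <= x <= 1 ->
    rtransfer a (S w) x = zr * S w x - zi * T w x - w x /\
    rtransfer a (T w) x = zr * T w x + zi * S w x.
  move=> hw x01.
  have e1 := neumann_shift ha hlam rho0 rho1 hs hw x01.
  have e2 := neumann_shift ha hlam rho0 rho1 ht hw x01.
  have E1 : forall y, 0 <= y <= 1 -> S w y =
      zr * neumann a (fun n => s n.+1) w y + (- zi) * neumann a (fun n => t n.+1) w y.
    move=> y y01; rewrite /S [in LHS]sE.
    exact: (neumann_lin ha hlam rho0 rho1 zr (- zi) hs' ht' hw y01).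
  have E2 : forall y, 0 <= y <= 1 -> T w y =
      zr * neumann a (fun n => t n.+1) w y + zi * neumann a (fun n => s n.+1) w y.
    move=> y y01; rewrite /T [in LHS]tE.
    exact: (neumann_lin ha hlam rho0 rho1 zr zi ht' hs' hw y01).
  rewrite (rtransfer_ceq a E1 x01) (rtransfer_ceq a E2 x01) !rtransferD !rtransferZ.
  have f1 : rtransfer a (neumann a (fun n => s n.+1) w) x = S w x - s 0%N * w x by rewrite /S e1; ring.
  have f2 : rtransfer a (neumann a (fun n => t n.+1) w) x = T w x - t 0%N * w x by rewrite /T e2; ring.
  rewrite f1 f2; split.
    rewrite -[in RHS](mul1r (w x)) -z10; ring.
  have -> : zr * (T w x - t 0%N * w x) + zi * (S w x - s 0%N * w x) =
    zr * T w x + zi * S w x - (zr * t 0%N + zi * s 0%N) * w x by ring.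
  by rewrite z01 mul0r subr0.
exists (fun x => - S u x + T v x), (fun x => - S v x + - T u x).
have bS w : cone_diff K w -> cone_diff (2 * (rho * (K * eigf_max lam) / (1 - rho * lam))) (S w).
  by move=> hw; exact: cone_diff_neumann hw.
have bT w : cone_diff K w -> cone_diff (2 * (rho * (K * eigf_max lam) / (1 - rho * lam))) (T w).
  by move=> hw; exact: cone_diff_neumann hw.
have kE : 4 * (rho * eigf_max lam / (1 - rho * lam)) * K = 2 * (rho * (K * eigf_max lam) / (1 - rho * lam)) +
  2 * (rho * (K * eigf_max lam) / (1 - rho * lam)) by ring.
split.
- by rewrite kE; apply: cone_diffD; [exact: cone_diffN (bS _ hu)|exact: bT _ hv].
- by rewrite kE; apply: cone_diffD; [exact: cone_diffN (bS _ hv)|exact: cone_diffN (bT _ hu)].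
move=> x x01; have [k1 k2] := key u x hu x01; have [k3 k4] := key v x hv x01.
rewrite /op_minus [LHS]complexE ReD ImD ReN ImN ReM ImM Re_transfer Im_transfer /=.
rewrite -/zr -/zi.
have -> : rtransfer a (fun y => - S u y + T v y) x = - rtransfer a (S u) x + rtransfer a (T v) x by rewrite /rtransfer; ring.
have -> : rtransfer a (fun y => - S v y + - T u y) x = - rtransfer a (S v) x - rtransfer a (T u) x by rewrite /rtransfer; ring.
by rewrite k1 k2 k3 k4; congr (_ +i* _); ring.
Qed.

Lemma resolvent_outside z : lam < Normc.normc z -> resolvent_set (transfer a) z.
Proof.
move=> hz; split; first by move=> f; exact: transfer_injective.
set c := 4 * ((Normc.normc z)^-1 * eigf_max lam / (1 - (Normc.normc z)^-1 * lam)).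
have z0 : 0 < Normc.normc z by apply: lt_trans hz.
have c0 : 0 <= c.
  have d0 : 0 <= 1 - (Normc.normc z)^-1 * lam.
    by rewrite subr_ge0 mulrC ler_pdivrMr// mul1r ltW.
  have C0 := ltW (eigf_max_gt0 hlam); have zi0 : 0 <= (Normc.normc z)^-1 by rewrite invr_ge0 ltW.
  by rewrite mulr_ge0// divr_ge0// mulr_ge0.
exists (6 * c * 10) => g /BVI_cone_diff[K [u [v [hu hv ge Kle]]]].
have [X [Y [hX hY e]]] := neumann_solve hz hu hv.
have [B1 B2] := cone_diff_BVI hX hY.
exists (fun x => X x +i* Y x); split => //.
  by apply: ae01_mono ge => x x01 ->; rewrite e.
apply: le_trans B2 _; rewrite -/c mulrA EFinM [X in (_ <= X * _)%E]EFinM -muleA.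
by apply: lee_wpmul2l => //; rewrite lee_fin mulr_ge0.
Qed.

Lemma leading_growth_rate : leading_eigenvalue (transfer a) lam.
Proof.
have hev : BV_eigenvalue (transfer a) lam%:C.
  by exists eigc; split; [exact: eigc_BVI|exact: eigc_neq0|exact: eigc_eigen].
split => //; apply/eqP; rewrite eq_le; apply/andP; split.
  apply: ereal_sup_ubound; exists lam%:C.
    move=> [inj _]; have [f [h1 h2 h3]] := hev; exact: h2 (inj f h1 h3).
  by rewrite /= expr0n /= addr0 sqrtr_sqr gtr0_norm.
apply: ge_ereal_sup => _ [z hz <-]; rewrite lee_fin leNgt; apply/negP => h.
exact: hz (resolvent_outside h).
Qed.

(** An element of the kernel of (L_a - lam)^(n+1) is mapped to a multiple of the
eigenfunction by induction; that multiple is 0, as there is no Jordan block. *)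
Lemma generalized_eigen_line n (u w : R -> R) K : cone_diff K w -> ae01 (fun x => u x = w x) ->
  ae01 (fun x => iter n (fun (g : R -> R) x => rtransfer a g x - lam * g x) u x = 0) ->
  exists k, ae01 (fun x => u x = k * e_ x).
Proof.
elim: n u w K => [|n IH] u w K hw huw h.
  by exists 0; apply: ae01_mono h => x _ /= ->; rewrite mul0r.
rewrite iterSr in h.
have hw' : cone_diff (K * (eigf_max lam * lam) + `|- lam| * K) (fun x => rtransfer a w x + - lam * w x).
  by apply: cone_diffD; [exact: cone_diff_rtransfer|exact: cone_diffZ].
have huw' : ae01 (fun x => rtransfer a u x - lam * u x = rtransfer a w x + - lam * w x).
  by apply: (ae01_mono2 _ huw (ae01_rtransfer a huw)) => x _ -> ->; rewrite mulNr.
have [k hk] := IH _ _ _ hw' huw' h.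
have hu : ae01 (fun x => rtransfer a u x = lam * u x + k * e_ x).
  by apply: ae01_mono hk => x _ <-; rewrite addrC subrK.
have k0 := no_jordan ha hlam hu hw huw.
have hu' : ae01 (fun x => rtransfer a u x = lam * u x).
  by apply: ae01_mono hu => x _ ->; rewrite k0 mul0r addr0.
exact: (eigen_line ha hlam hu' hw huw).
Qed.

Lemma simple_growth_rate : simple (transfer a) lam%:C.
Proof.
exists eigc.
  split; last exact: eigc_neq0.
  by split; [exact: eigc_BVI | exists 1%N; exact: eigc_eigen].
move=> g [/BVI_cone_diff[K [u [v [hu hv ge _]]]] [n hn]].
pose opr := fun (g : R -> R) x => rtransfer a g x - lam * g x.
have ReE m x : complex.Re (iter m (op_minus (transfer a) lam%:C) g x) =
    iter m opr (fun y => complex.Re (g y)) x.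
  elim: m x => //= m IH x; rewrite /op_minus ReD ReN ReM Re_transfer /= mul0r subr0 /opr IH.
  by congr (rtransfer a _ x - _); apply/funext => y; exact: IH.
have ImE m x : complex.Im (iter m (op_minus (transfer a) lam%:C) g x) =
    iter m opr (fun y => complex.Im (g y)) x.
  elim: m x => //= m IH x; rewrite /op_minus ImD ImN ImM Im_transfer /= mul0r addr0 /opr IH.
  by congr (rtransfer a _ x - _); apply/funext => y; exact: IH.
have h1 : ae01 (fun x => iter n opr (fun y => complex.Re (g y)) x = 0).
  by apply: ae01_mono hn => x _ h; rewrite -ReE h.
have h2 : ae01 (fun x => iter n opr (fun y => complex.Im (g y)) x = 0).
  by apply: ae01_mono hn => x _ h; rewrite -ImE h.
have gu : ae01 (fun x => complex.Re (g x) = u x) by apply: ae01_mono ge => x _ ->.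
have gv : ae01 (fun x => complex.Im (g x) = v x) by apply: ae01_mono ge => x _ ->.
have [k hk] := generalized_eigen_line hu gu h1; have [k' hk'] := generalized_eigen_line hv gv h2.
exists (k +i* k'); apply: (ae01_mono2 _ hk hk') => x _ e1 e2.
rewrite [LHS]complexE [RHS]complexE ReM ImM /= e1 e2; congr (_ +i* _); ring.
Qed.

End spectral.

Theorem corollary6p5 (R : realType) (a : R) (ha : 1 / 2 < a < 1) :
  (exists r : R, leading_eigenvalue (transfer a) r /\ simple (transfer a) r%:C)
  /\
  let X : set R^o := `]1 / 2, 1[%classic in
  let h : R^o -> R^o := fun b => htop `[b, 1]%classic in
  hoelder_continuous_at X h a /\ h a / ln 2 <= Hoel X h a.
Proof.
split; last exact: htop_hoelder_ge.
have [lam hlam] := growth_rate_ex ha; exists lam.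
by split; [exact: leading_growth_rate|exact: simple_growth_rate].
Qed.
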